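(* Let $(M,E)$ be a Finsler space with Chern connection $\overset{\ast}{D}$. The $h$-torsion, $hv$-torsion and $v$-torsion of $\overset{\ast}{D}$ are given, for all $X,Y\in\mathfrak{X}(TM)$, by: (a) $\overset{\ast}{T}(hX,hY)=\mathfrak{R}(X,Y)$; (b) $\overset{\ast}{T}(hX,JY)=\mathcal{C}'(X,Y)$; (c) $\overset{\ast}{T}(JX,JY)=0$.
   Context: Setting. $M$ is a real $C^\infty$ manifold of finite dimension $n$, $TM$ its tangent bundle, $\mathcal{T}M$ the bundle of nonzero tangent vectors. $J$ is the natural almost-tangent structure (vertical endomorphism) of $TM$ (locally $J(\partial/\partial x^i)=\partial/\partial y^i$, $J(\partial/\partial y^i)=0$) and $C=y^i\partial/\partial y^i$ is the Liouville vector field. Brackets of vector forms are Frölicher-Nijenhuis brackets; for a vector $1$-form $L$ and vector field $X$, $[X,L]Y=[X,LY]-L[X,Y]$, $[L,X]=-[X,L]$. Finsler space $(M,E)$: $E:TM\to\mathbb{R}$ with $E>0$ on $\mathcal{T}M$, $E(0)=0$, $E$ $C^\infty$ on $\mathcal{T}M$ and $C^1$ on $TM$, $\mathcal{L}_CE=2E$, and $\Omega:=dd_JE$ of maximal rank, where $d_JE(X)=dE(JX)$. Canonical spray $S$: $i_S\Omega=-dE$. Barthel connection: $\Gamma=[J,S]$, with projectors $h=\frac12(I+\Gamma)$, $v=\frac12(I-\Gamma)$; its curvature is $\mathfrak{R}=-\frac12[h,h]$, i.e. $\mathfrak{R}(X,Y)=-v[hX,hY]$. The almost-complex structure $F$ is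 defined by $FJ=h$, $Fh=-J$; the metric is $g(X,Y)=\Omega(X,FY)$. $\mathcal{C}'$ is the symmetric vertical-valued bilinear tensor defined by $\Omega(\mathcal{C}'(X,Y),Z)=\frac12(\mathcal{L}_{hX}g)(JY,JZ)$. Regularity convention: objects built from $E$ are smooth only on $\mathcal{T}M$; linear connections on $TM$ and vector fields in $\mathfrak{X}(TM)$ are understood on $\mathcal{T}M$. Chern connection: the unique linear connection $\overset{\ast}{D}$ on $TM$ such that $\overset{\ast}{D}J=0$, $\overset{\ast}{D}C=v$, $\overset{\ast}{D}\Gamma=0$, $\overset{\ast}{D}_{JX}JY=J[JX,Y]$ (i.e. a normal lift of $\Gamma$), $\overset{\ast}{D}_{hX}g=0$, and $J\,\overset{\ast}{T}(hX,hY)=0$ for all $X,Y$, where $\overset{\ast}{T}(X,Y)=\overset{\ast}{D}_XY-\overset{\ast}{D}_YX-[X,Y]$ is its classical torsion. Explicitly it is determined by $\overset{\ast}{D}_{JX}JY=J[JX,Y]$, $\overset{\ast}{D}_{hX}JY=v[hX,JY]+\mathcal{C}'(X,Y)$, $\overset{\ast}{D}F=0$. Its $h$-, $hv$- and $v$-torsions are $\overset{\ast}{T}(hX,hY)$, $\overset{\ast}{T}(hX,JY)$, $\overset{\ast}{T}(JX,JY)$. *)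

(* Defs.v *)
From mathcomp Require Export all_boot all_order all_algebra.
From mathcomp Require Export all_classical all_reals all_analysis.

Set Implicit Arguments.
Unset Strict Implicit.
Unset Printing Implicit Defensive.

Export Order.TTheory GRing.Theory Num.Theory numFieldNormedType.Exports.

Local Open Scope classical_set_scope.
Local Open Scope ring_scope.

(* C^k on the open set O.  For k > 0, f is Frechet differentiable at each
   point of O and every directional derivative x |-> 'd f x v is C^(k-1);
   on a finite-dimensional space this is the usual class C^k. *)
Fixpoint Ck_on (R : realType) (V W : normedModType R) (k : nat) (O : set V)
    (f : V -> W) : Prop :=
  match k with
  | 0 => forall x, O x -> {for x, continuous f}
  | k'.+1 => (forall x, O x -> differentiable f x) /\
             (forall v, Ck_on k' O (fun x => 'd f x v))
  end.

Definition smooth_on (R : realType) (V W : normedModType R) (O : set V)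
    (f : V -> W) : Prop :=
  forall k, Ck_on k O f.

(* Charts of T with values in V, together with the choice of a chart around
   each point.  A tangent vector at p is encoded by its components u : V in
   the chart [chart_at p]; a vector field on T is thus a map T -> V. *)
Record atlas (V T : Type) : Type := Atlas {
  chart_index : Type;
  dom : chart_index -> set T;
  coord : chart_index -> T -> V;
  chart_at : T -> chart_index
}.

(* The local representative of f in the chart a, that is f \o (coord a)^-1 on
   [coord_dom a]; it is 0 elsewhere. *)
Definition loc (R : realType) (V W : normedModType R) (T : Type)
    (N : atlas V T) (f : T -> W) (a : chart_index N) : V -> W :=
  fun x => xget 0 [set f p | p in [set p | dom a p /\ coord a p = x]].

Definition coord_dom (V T : Type) (N : atlas V T) (a : chart_index N) : set V :=
  coord a @` dom a.

Definition transition (R : realType) (V : normedModType R) (T : Type)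
    (N : atlas V T) (a b : chart_index N) : V -> V :=
  loc (coord b) a.

(* T carries a smooth manifold structure with atlas N.  The equivalence in
   the fourth clause says that [coord a] restricts to a homeomorphism of
   [dom a] onto an open subset of V.  No countability axiom is imposed. *)
Definition smooth_manifold (R : realType) (V : normedModType R)
    (T : topologicalType) (N : atlas V T) : Prop :=
  [/\ hausdorff_space T,
      forall p, dom (chart_at N p) p,
      forall a : chart_index N, open (dom a) /\
        (forall p q, dom a p -> dom a q -> coord a p = coord a q -> p = q),
      forall (a : chart_index N) (B : set T), B `<=` dom a ->
        (open B <-> open (coord a @` B)) &
      forall a b : chart_index N,
        smooth_on (coord a @` (dom a `&` dom b)) (transition a b)].

(* Components in the chart b of the tangent vector at p whose components in
   the chart a are u. *)
Definition change (R : realType) (V : normedModType R) (T : Type)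
    (N : atlas V T) (a b : chart_index N) (p : T) (u : V) : V :=
  'd (transition a b) (coord a p) u.

Definition Ck_fun (R : realType) (V : normedModType R) (T : Type)
    (N : atlas V T) (k : nat) (f : T -> R) : Prop :=
  forall a : chart_index N, Ck_on k (coord_dom a) (loc f a).

Definition smooth_fun (R : realType) (V : normedModType R) (T : Type)
    (N : atlas V T) (f : T -> R) : Prop :=
  forall a : chart_index N, smooth_on (coord_dom a) (loc f a).

(* The map x |-> (components of X at x) in the chart a. *)
Definition vrep (R : realType) (V : normedModType R) (T : Type)
    (N : atlas V T) (X : T -> V) (a : chart_index N) : V -> V :=
  loc (fun p => change (chart_at N p) a p (X p)) a.

Definition smooth_vf (R : realType) (V : normedModType R) (T : Type)
    (N : atlas V T) (X : T -> V) : Prop :=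
  forall a : chart_index N, smooth_on (coord_dom a) (vrep X a).

Definition dfun (R : realType) (V : normedModType R) (T : Type)
    (N : atlas V T) (f : T -> R) (p : T) (u : V) : R :=
  'd (loc f (chart_at N p)) (coord (chart_at N p) p) u.

Definition lie_fun (R : realType) (V : normedModType R) (T : Type)
    (N : atlas V T) (X : T -> V) (f : T -> R) : T -> R :=
  fun p => dfun N f p (X p).

Definition bracket (R : realType) (V : normedModType R) (T : Type)
    (N : atlas V T) (X Y : T -> V) : T -> V :=
  fun p => let a := chart_at N p in
    'd (vrep Y a) (coord a p) (X p) - 'd (vrep X a) (coord a p) (Y p).

(* Exterior derivative of the 1-form om, without a factor 1/2:
   (d om)(X, Y) = X om(Y) - Y om(X) - om([X, Y]).  It is computed with the
   coordinate representative of om, paired with constant vectors. *)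
Definition orep (R : realType) (V : normedModType R) (T : Type)
    (N : atlas V T) (om : T -> V -> R) (a : chart_index N) (w : V) : V -> R :=
  loc (fun p => om p (change a (chart_at N p) p w)) a.

Definition ext_d (R : realType) (V : normedModType R) (T : Type)
    (N : atlas V T) (om : T -> V -> R) : T -> V -> V -> R :=
  fun p u w => let a := chart_at N p in
    'd (orep om a w) (coord a p) u - 'd (orep om a u) (coord a p) w.

Definition fscale (R : realType) (V : normedModType R) (T : Type)
    (f : T -> R) (X : T -> V) : T -> V :=
  fun p => f p *: X p.

(* A vector 1-form, as a smooth field of endomorphisms. *)
Definition vector_1form (R : realType) (V : normedModType R) (T : Type)
    (N : atlas V T) (L : T -> V -> V) : Prop :=
  (forall p (a : R) u w, L p (a *: u + w) = a *: L p u + L p w) /\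
  (forall X, smooth_vf N X -> smooth_vf N (fun p => L p (X p))).

Definition symmetric_bilinear (R : realType) (V : normedModType R) (T : Type)
    (N : atlas V T) (B : T -> V -> V -> V) : Prop :=
  [/\ forall p (a : R) u u' w, B p (a *: u + u') w = a *: B p u w + B p u' w,
      forall p u w, B p u w = B p w u &
      forall X Y, smooth_vf N X -> smooth_vf N Y ->
        smooth_vf N (fun p => B p (X p) (Y p))].

(* Froelicher-Nijenhuis brackets [X, L], [L, X] and [K, L], vector 1-forms being
   given by their action on vector fields. *)
Definition fn_vec_form (R : realType) (V : normedModType R) (T : Type)
    (N : atlas V T) (X : T -> V) (L : (T -> V) -> (T -> V)) :
    (T -> V) -> (T -> V) :=
  fun Y => bracket N X (L Y) - L (bracket N X Y).

Definition fn_form_vec (R : realType) (V : normedModType R) (T : Type)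
    (N : atlas V T) (L : (T -> V) -> (T -> V)) (X : T -> V) :
    (T -> V) -> (T -> V) :=
  fun Y => - fn_vec_form N X L Y.

Definition fn_form_form (R : realType) (V : normedModType R) (T : Type)
    (N : atlas V T) (K L : (T -> V) -> (T -> V)) :
    (T -> V) -> (T -> V) -> (T -> V) :=
  fun X Y => bracket N (K X) (L Y) + bracket N (L X) (K Y)
    + K (L (bracket N X Y)) + L (K (bracket N X Y))
    - K (bracket N X (L Y)) - K (bracket N (L X) Y)
    - L (bracket N X (K Y)) - L (bracket N (K X) Y).

Record linear_connection (R : realType) (V : normedModType R) (T : Type)
    (N : atlas V T) (D : (T -> V) -> (T -> V) -> (T -> V)) : Prop := {
  conn_smooth : forall X Y, smooth_vf N X -> smooth_vf N Y ->
    smooth_vf N (D X Y);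
  conn_addl : forall X X' Y, smooth_vf N X -> smooth_vf N X' ->
    smooth_vf N Y -> D (X + X') Y = D X Y + D X' Y;
  conn_scalel : forall f X Y, smooth_fun N f -> smooth_vf N X ->
    smooth_vf N Y -> D (fscale f X) Y = fscale f (D X Y);
  conn_addr : forall X Y Y', smooth_vf N X -> smooth_vf N Y ->
    smooth_vf N Y' -> D X (Y + Y') = D X Y + D X Y';
  conn_leibniz : forall f X Y, smooth_fun N f -> smooth_vf N X ->
    smooth_vf N Y ->
    D X (fscale f Y) = fscale (lie_fun N X f) Y + fscale f (D X Y)
}.

Definition torsion (R : realType) (V : normedModType R) (T : Type)
    (N : atlas V T) (D : (T -> V) -> (T -> V) -> (T -> V)) (X Y : T -> V) :
    T -> V :=
  D X Y - D Y X - bracket N X Y.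

(* The pair (p, v) stands for the tangent vector at p with components v in
   the chart [chart_at p].  The smooth structure of TM is that of
   [tangent_atlas], not a product structure. *)
Definition TM (V M : Type) : Type := (M * V)%type.

Definition slitTM (R : realType) (V : normedModType R) (M : Type) : Type :=
  {z : TM V M | z.2 != 0}.

(* The charts (x^i, y^i) induced by the charts (x^i) of M. *)
Definition tangent_atlas (R : realType) (V : normedModType R) (M : Type)
    (A : atlas V M) : atlas (V * V)%type (TM V M) :=
  {| chart_index := chart_index A;
     dom := fun a => [set z : TM V M | dom a z.1];
     coord := fun a z => (coord a z.1, change (chart_at A z.1) a z.1 z.2);
     chart_at := fun z => chart_at A z.1 |}.

Definition slit_atlas (R : realType) (V : normedModType R) (M : Type)
    (A : atlas V M) : atlas (V * V)%type (slitTM V M) :=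
  {| chart_index := chart_index A;
     dom := fun a => [set z : slitTM V M | dom (a : chart_index A) (val z).1];
     coord := fun a z => coord (a : chart_index (tangent_atlas A)) (val z);
     chart_at := fun z => chart_at A (val z).1 |}.

(* A vector tangent to TM has components (u.1, u.2) with respect to the basis
   (d/dx^i, d/dy^i) of an induced chart; the expressions below for the
   vertical endomorphism and the Liouville field are the same in all of
   them. *)
Definition Jvec (R : realType) (V : normedModType R) (u : V * V) : V * V :=
  (0, u.1).

Definition J (R : realType) (V : normedModType R) (M : Type)
    (X : slitTM V M -> V * V) : slitTM V M -> V * V :=
  fun z => Jvec (X z).

Definition liouvilleTM (R : realType) (V : normedModType R) (M : Type) :
    TM V M -> V * V :=
  fun z => (0, z.2).

Definition liouville (R : realType) (V : normedModType R) (M : Type) :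
    slitTM V M -> V * V :=
  fun z => liouvilleTM (val z).

Definition slit_fun (R : realType) (V : normedModType R) (M : Type)
    (E : TM V M -> R) : slitTM V M -> R :=
  fun z => E (val z).

(* Omega = d d_J E *)
Definition fundamental_form (R : realType) (V : normedModType R) (M : Type)
    (A : atlas V M) (E : TM V M -> R) : slitTM V M -> V * V -> V * V -> R :=
  ext_d (slit_atlas A)
    (fun z u => dfun (slit_atlas A) (slit_fun E) z (Jvec u)).

Definition std_basis (R : realType) (n : nat) (i : 'I_(n + n)) :
    'rV[R]_n * 'rV[R]_n :=
  (lsubmx (delta_mx 0 i : 'rV[R]_(n + n)),
   rsubmx (delta_mx 0 i : 'rV[R]_(n + n))).

Definition form_rank (R : realType) (n : nat)
    (B : 'rV[R]_n * 'rV[R]_n -> 'rV[R]_n * 'rV[R]_n -> R) : nat :=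
  \rank (\matrix_(i < n + n, j < n + n)
           B (@std_basis R n i) (@std_basis R n j)).

Record finsler_space (R : realType) (n : nat) (M : topologicalType)
    (A : atlas 'rV[R]_n M) (E : TM 'rV[R]_n M -> R) : Prop := {
  finsler_manifold : smooth_manifold A;
  finsler_gt0 : forall z : TM 'rV[R]_n M, z.2 != 0 -> 0 < E z;
  finsler_0 : forall p : M, E (p, 0) = 0;
  finsler_smooth : smooth_fun (slit_atlas A) (slit_fun E);
  finsler_C1 : Ck_fun (tangent_atlas A) 1 E;
  finsler_homogeneous : forall z : TM 'rV[R]_n M,
    lie_fun (tangent_atlas A) (@liouvilleTM R _ M) E z = 2 * E z;
  finsler_rank : forall z : slitTM 'rV[R]_n M,
    form_rank (fundamental_form A E z) = (n + n)%N
}.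

Definition canonical_spray (R : realType) (n : nat) (M : topologicalType)
    (A : atlas 'rV[R]_n M) (E : TM 'rV[R]_n M -> R)
    (S : slitTM 'rV[R]_n M -> 'rV[R]_n * 'rV[R]_n) : Prop :=
  smooth_vf (slit_atlas A) S /\
  (forall z u, fundamental_form A E z (S z) u
               = - dfun (slit_atlas A) (slit_fun E) z u).

(* Gamma = [J, S] *)
Definition barthel (R : realType) (V : normedModType R) (M : Type)
    (A : atlas V M) (S X : slitTM V M -> V * V) : slitTM V M -> V * V :=
  fn_form_vec (slit_atlas A) (@J R V M) S X.

Definition hproj (R : realType) (V : normedModType R) (M : Type)
    (A : atlas V M) (S X : slitTM V M -> V * V) : slitTM V M -> V * V :=
  2^-1 *: (X + barthel A S X).

Definition vproj (R : realType) (V : normedModType R) (M : Type)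
    (A : atlas V M) (S X : slitTM V M -> V * V) : slitTM V M -> V * V :=
  2^-1 *: (X - barthel A S X).

(* - 1/2 [h, h], which is - v[hX, hY] *)
Definition curvature (R : realType) (V : normedModType R) (M : Type)
    (A : atlas V M) (S X Y : slitTM V M -> V * V) : slitTM V M -> V * V :=
  - (2^-1 *: fn_form_form (slit_atlas A) (hproj A S) (hproj A S) X Y).

Definition almost_complex (R : realType) (V : normedModType R) (M : Type)
    (A : atlas V M) (S : slitTM V M -> V * V)
    (F : slitTM V M -> V * V -> V * V) : Prop :=
  vector_1form (slit_atlas A) F /\
  (forall X, smooth_vf (slit_atlas A) X ->
     (fun z => F z (J X z)) = hproj A S X /\
     (fun z => F z (hproj A S X z)) = - J X).

Definition metric (R : realType) (V : normedModType R) (M : Type)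
    (A : atlas V M) (E : TM V M -> R) (F : slitTM V M -> V * V -> V * V)
    (X Y : slitTM V M -> V * V) : slitTM V M -> R :=
  fun z => fundamental_form A E z (X z) (F z (Y z)).

(* (L_X g)(Y, Z) *)
Definition lie_metric (R : realType) (V : normedModType R) (M : Type)
    (A : atlas V M) (E : TM V M -> R) (F : slitTM V M -> V * V -> V * V)
    (X Y Z : slitTM V M -> V * V) : slitTM V M -> R :=
  lie_fun (slit_atlas A) X (metric A E F Y Z)
  - metric A E F (bracket (slit_atlas A) X Y) Z
  - metric A E F Y (bracket (slit_atlas A) X Z).

Definition cartan_prime (R : realType) (V : normedModType R) (M : Type)
    (A : atlas V M) (E : TM V M -> R) (S : slitTM V M -> V * V)
    (F : slitTM V M -> V * V -> V * V)
    (C' : slitTM V M -> V * V -> V * V -> V * V) : Prop :=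
  [/\ symmetric_bilinear (slit_atlas A) C',
      forall z u w, Jvec (C' z u w) = 0 &
      forall X Y Z, smooth_vf (slit_atlas A) X -> smooth_vf (slit_atlas A) Y ->
        smooth_vf (slit_atlas A) Z -> forall z,
        fundamental_form A E z (C' z (X z) (Y z)) (Z z)
        = 2^-1 * lie_metric A E F (hproj A S X) (J Y) (J Z) z].

Record chern_connection (R : realType) (V : normedModType R) (M : Type)
    (A : atlas V M) (E : TM V M -> R) (S : slitTM V M -> V * V)
    (F : slitTM V M -> V * V -> V * V)
    (D : (slitTM V M -> V * V) -> (slitTM V M -> V * V) ->
         (slitTM V M -> V * V)) : Prop := {
  chern_linear : linear_connection (slit_atlas A) D;
  chern_J : forall X Y, smooth_vf (slit_atlas A) X ->
    smooth_vf (slit_atlas A) Y -> D X (J Y) = J (D X Y);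
  chern_C : forall X, smooth_vf (slit_atlas A) X ->
    D X (@liouville R V M) = vproj A S X;
  chern_Gamma : forall X Y, smooth_vf (slit_atlas A) X ->
    smooth_vf (slit_atlas A) Y ->
    D X (barthel A S Y) = barthel A S (D X Y);
  chern_vertical : forall X Y, smooth_vf (slit_atlas A) X ->
    smooth_vf (slit_atlas A) Y ->
    D (J X) (J Y) = J (bracket (slit_atlas A) (J X) Y);
  chern_metric : forall X Y Z, smooth_vf (slit_atlas A) X ->
    smooth_vf (slit_atlas A) Y -> smooth_vf (slit_atlas A) Z ->
    lie_fun (slit_atlas A) (hproj A S X) (metric A E F Y Z)
    = metric A E F (D (hproj A S X) Y) Z
      + metric A E F Y (D (hproj A S X) Z);
  chern_torsion : forall X Y, smooth_vf (slit_atlas A) X ->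
    smooth_vf (slit_atlas A) Y ->
    J (torsion (slit_atlas A) D (hproj A S X) (hproj A S Y)) = 0
}.

(* Main.v *)
From HB Require Import structures.
Require Import Defs.
From mathcomp Require Import ring lra.

Set Implicit Arguments.
Unset Strict Implicit.
Unset Printing Implicit Defensive.

Local Open Scope classical_set_scope.
Local Open Scope ring_scope.

(** The three identities are algebraic consequences of the defining properties
    of the Chern connection D, once the Lie algebra of vector fields on the slit
    bundle, the vertical endomorphism J and the Barthel connection
    Gamma = [J, S], with projectors h and v, are under control.

    (c) The vertical part of D is J[JX, Y], so the v-torsion is minus the
    Nijenhuis tensor of J, which vanishes ([bracket_JJ]).

    (a) The torsion of hX and hY is vertical by hypothesis, and D preserves
    horizontal fields because D Gamma = 0.  Hence it is the vertical part of
    - [hX, hY].  This is - 1/2 [h, h] because the bracket of two vertical fields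
    is vertical ([J_bracket_vertical]).

    (b) In the same way T(hX, JY) = D_hX JY - v[hX, JY]; call this vertical
    vector B(X, Y) ([berwald_difference]).  It remains to see that B = C'.
    Horizontal metricity gives
      (L_hX g)(JY, JZ) = Omega(B(X, Y), Z) + Omega(B(X, Z), Y)
    ([lie_metricE]); the left side is 2 Omega(C'(X, Y), Z).  The torsion
    hypothesis makes B symmetric ([berwald_differenceC]), and C' is symmetric by
    definition, so the usual Christoffel argument makes Omega(B(X, Y), Z)
    totally symmetric.  Then Omega(C' - B, Z) = 0 for every field Z, and Omega
    is nondegenerate.

    Three facts about the Barthel connection are needed:
    - J S = C: both Omega(J S, .) and Omega(C, .) equal d_J E, the second one by
      homogeneity ([J_spray]); this makes h a projector with J h = J;
    - the horizontal distribution is Lagrangian ([Om_hor]): Omega is closed and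
      i_S Omega = - dE, so L_S Omega = 0, and differentiating
      Omega(JX, Y) + Omega(X, JY) = 0 along S gives
      Omega(Gamma X, Y) + Omega(X, Gamma Y) = 0;
    - [J, Gamma] = 0 ([barthel_torsion]), by the Jacobi identity and the
      vanishing of the Nijenhuis tensor of J.

    These are identities between globally defined fields, whereas nondegeneracy
    of Omega concerns tangent vectors at a point.  The link is that every
    tangent vector is the value of a smooth vector field
    ([smooth_extension]), by means of a bump function on M. *)

(** * Differentials and functions of class C^k *)

Section DiffBasics.
Context {R : realType}.
Implicit Types V W U : normedModType R.

Lemma near_diff V W (f g : V -> W) x : (\near x, f x = g x) ->
  differentiable f x ->
  differentiable g x /\ 'd g x = 'd f x :> (V -> W).
Proof.
move=> fg df; have [cdf /eqaddoP fo] := (diff_locallyP x f).1 df.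
have go : g \o shift x = cst (g x) + 'd f x +o_ 0 id.
  apply/eqaddoP => e e0; have := fo e e0.
  have : \forall y \near (0 : V), f (y + x) = g (y + x).
    by move: fg; rewrite (near_shift 0 x) subr0.
  apply: filterS2 => y fgy; congr (_ <= _).
  by rewrite !fctE /= fgy (nbhs_singleton fg).
have dE : 'd g x = 'd f x :> (V -> W) by exact: diff_unique.
split; last exact: dE.
apply/diff_locallyP; split; rewrite dE; [exact: cdf | exact: go].
Qed.

Lemma is_diff_ex V W (f df : V -> W) x : is_diff x f df -> differentiable f x.
Proof. by case. Qed.

Lemma is_diff_val V W (f df : V -> W) x : is_diff x f df ->
  'd f x = df :> (V -> W).
Proof. by case. Qed.

Lemma scaler_is_bilinear W :
  bilinear_for
    (GRing.Scale.Law.clone _ _ *:%R _) (GRing.Scale.Law.clone _ _ *:%R _)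
    (@GRing.scale R W : R -> W -> W).
Proof.
split=> [u|u] a x y /=; first by rewrite scalerDl scalerA.
by rewrite scalerDr !scalerA mulrC.
Qed.

HB.instance Definition _ W := bilinear_isBilinear.Build R R W W _ _
  (@GRing.scale R W : R -> W -> W) (@scaler_is_bilinear W).

Lemma is_diff_scale V W (f : V -> R) (g : V -> W) x :
  differentiable f x -> differentiable g x ->
  is_diff x (fun y => f y *: g y) (fun v => f x *: 'd g x v + 'd f x v *: g x).
Proof.
move=> df dg.
have -> : (fun y => f y *: g y) =
  (fun p : R * W => p.1 *: p.2) \o (fun y => (f y, g y)) by [].
have c : continuous (fun p : R * W => p.1 *: p.2).
  by move=> p; exact: scale_continuous.
have dp := differentiable_pair df dg.
have db := @differentiable_bilin R R W W (@GRing.scale R W : R -> W -> W)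
  (f x, g x) c.
apply: DiffDef; first exact: differentiable_comp.
rewrite diff_comp //.
rewrite (@diff_bilin R R W W (@GRing.scale R W : R -> W -> W)) //.
by rewrite diff_pair.
Qed.

Lemma is_diff_ext V W (f g df dg : V -> W) x : f =1 g -> df =1 dg ->
  is_diff x f df -> is_diff x g dg.
Proof. by move=> /funext -> /funext ->. Qed.

Lemma is_diff_near V W (f g df : V -> W) x : (\near x, f x = g x) ->
  is_diff x f df -> is_diff x g df.
Proof.
move=> fg hf; have [dg dE] := near_diff fg (is_diff_ex hf).
apply: DiffDef; first exact: dg.
by rewrite dE; exact: (is_diff_val hf).
Qed.

Lemma is_diff_app V W (f df : V -> W) x u : is_diff x f df -> 'd f x u = df u.
Proof. by move=> hf; rewrite (is_diff_val hf). Qed.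

Lemma is_diff_near_val V W (f g df : V -> W) x u : (\near x, f x = g x) ->
  is_diff x f df -> 'd g x u = df u.
Proof. by move=> fg hf; rewrite (is_diff_val (is_diff_near fg hf)). Qed.

End DiffBasics.

(** Finite-dimensionality, in the form used to reduce calculus to scalar
    functions; a spanning family with continuous linear coordinates suffices. *)
Record fin_basis (R : realType) (V : normedModType R) := FinBasis {
  bdim : nat;
  bvec : 'I_bdim -> V;
  bco : 'I_bdim -> {linear V -> R};
  bco_cont : forall i, continuous (bco i);
  bcoE : forall v, v = \sum_(i < bdim) bco i v *: bvec i
}.

Arguments bvec {R V} f i.
Arguments bco {R V} f i.
Arguments bco_cont {R V} f i.

(** Reduces identities between vectors to identities in R, where ring
    normalization applies. *)
Lemma bco_inj (R : realType) (V : normedModType R) (B : fin_basis V) (u v : V) :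
  (forall i, bco B i u = bco B i v) -> u = v.
Proof.
by move=> uv; rewrite (bcoE B u) (bcoE B v); apply: eq_bigr => i _; rewrite uv.
Qed.

Section Basis.
Context {R : realType}.

Definition real_basis : fin_basis R.
Proof.
apply: (@FinBasis R R 1 (fun=> 1) (fun=> idfun)).
- by move=> i x; exact: cvg_id.
- by move=> v; rewrite big_ord_recl big_ord0 addr0 /GRing.scale /= mulr1.
Defined.

Lemma rV_coord_linear n (i : 'I_n) : linear (fun v : 'rV[R]_n => v 0 i : R).
Proof. by move=> a u v; rewrite !mxE. Qed.

Definition rV_coord n (i : 'I_n) : {linear 'rV[R]_n -> R} :=
  HB.pack (fun v : 'rV[R]_n => v 0 i : R)
    (GRing.isLinear.Build R 'rV[R]_n R *%R _ (rV_coord_linear i)).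

Definition rV_basis n : fin_basis 'rV[R]_n :=
  @FinBasis R 'rV[R]_n n (fun i => delta_mx 0 i) (@rV_coord n)
    (fun i => @coord_continuous _ 1 n 0 i) (@row_sum_delta R n).

Definition prod_basis (V W : normedModType R) (B : fin_basis V)
  (C : fin_basis W) : fin_basis (V * W)%type.
Proof.
pose L (i : 'I_(bdim B + bdim C)) : V * W -> R :=
  match fintype.split i with inl j => bco B j \o fst | inr j => bco C j \o snd end.
have lin i : linear (L i).
  by rewrite /L; case: fintype.split => j a u v /=; rewrite linearP.
pose e (i : 'I_(bdim B + bdim C)) : V * W :=
  match fintype.split i with inl j => (bvec B j, 0) | inr j => (0, bvec C j) end.
pose LL i : {linear (V * W)%type -> R} :=
  HB.pack (L i) (GRing.isLinear.Build R (V * W)%type R *%R _ (lin i)).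
apply: (@FinBasis R (V * W)%type (bdim B + bdim C) e LL).
- move=> i; rewrite /LL /= /L; case: fintype.split => j x /=.
    by apply: continuous_comp; [exact: cvg_fst | exact: bco_cont].
  by apply: continuous_comp; [exact: cvg_snd | exact: bco_cont].
- move=> [v w]; rewrite big_split_ord /=.
  rewrite (eq_bigr (fun j => (bco B j v *: bvec B j, 0))); last first.
    move=> j _; rewrite /L /e -[lshift _ j]/(unsplit (inl j)) unsplitK /=.
    by apply: injective_projections; rewrite /= ?scaler0.
  rewrite [X in _ + X](eq_bigr (fun j => (0, bco C j w *: bvec C j))); last first.
    move=> j _; rewrite /L /e -[rshift _ j]/(unsplit (inr j)) unsplitK /=.
    by apply: injective_projections; rewrite /= ?scaler0.
  have -> : \sum_(i < bdim B) (bco B i v *: bvec B i, 0) = (v, 0 : W).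
    rewrite [in RHS](bcoE B v).
    rewrite [RHS](big_morph (fun x : V => (x, 0 : W)) (id1 := 0) (op1 := +%R)) //.
    by move=> x y; apply: injective_projections; rewrite /= ?addr0.
  have -> : \sum_(i < bdim C) (0, bco C i w *: bvec C i) = (0 : V, w).
    rewrite [in RHS](bcoE C w).
    rewrite [RHS](big_morph (fun x : W => (0 : V, x)) (id1 := 0) (op1 := +%R)) //.
    by move=> x y; apply: injective_projections; rewrite /= ?addr0.
  by apply: injective_projections; rewrite /= ?addr0 ?add0r.
Defined.

End Basis.

Section Ck.
Context {R : realType}.
Implicit Types V W U Z : normedModType R.

Lemma open_near V (O : set V) (P : V -> Prop) x : open O -> O x ->
  (forall y, O y -> P y) -> \near x, P x.
Proof. by move=> oO Ox OP; apply: filterS OP (open_nbhs_nbhs (conj oO Ox)). Qed.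

Lemma Ck_ext V W k (O : set V) (f g : V -> W) : open O ->
  (forall x, O x -> f x = g x) -> Ck_on k O f -> Ck_on k O g.
Proof.
move=> oO; elim: k f g => [|k IH] f g fg /=.
  move=> fc x Ox; have n := open_near oO Ox fg.
  change (g @ x --> g x); rewrite -(fg x Ox); apply: cvg_trans (fc x Ox).
  exact: near_eq_cvg.
move=> [df Cf]; split=> [x Ox|v].
  by have [] := near_diff (open_near oO Ox fg) (df x Ox).
apply: (IH (fun x => 'd f x v) _ _ (Cf v)) => x Ox.
by have [_ ->] := near_diff (open_near oO Ox fg) (df x Ox).
Qed.

Lemma Ck_S V W k (O : set V) (f : V -> W) (df : V -> V -> W) : open O ->
  (forall x, O x -> is_diff x f (df x)) ->
  (forall v, Ck_on k O (fun x => df x v)) -> Ck_on k.+1 O f.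
Proof.
move=> oO Hf Cf; split=> [x Ox|v]; first exact: (is_diff_ex (Hf x Ox)).
apply: Ck_ext (Cf v) => // x Ox.
by rewrite (is_diff_val (Hf x Ox)).
Qed.

Lemma Ck_pred V W k (O : set V) (f : V -> W) : Ck_on k.+1 O f -> Ck_on k O f.
Proof.
elim: k f => [|k IH] f [df Cf].
  by move=> x Ox; exact: (differentiable_continuous (df x Ox)).
by split=> // v; apply: IH.
Qed.

Lemma Ck_is_diff V W k (O : set V) (f : V -> W) x : Ck_on k.+1 O f -> O x ->
  is_diff x f ('d f x).
Proof. by move=> [df _] Ox; exact: differentiableP (df x Ox). Qed.

Lemma Ck_d V W k (O : set V) (f : V -> W) v : Ck_on k.+1 O f ->
  Ck_on k O (fun x => 'd f x v).
Proof. by move=> [_ /(_ v)]. Qed.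

Lemma Ck_union V W k (O O' : set V) (f : V -> W) :
  Ck_on k O f -> Ck_on k O' f -> Ck_on k (O `|` O') f.
Proof.
elim: k f => [|k IH] f /= => [c c' x [/c|/c']//|].
move=> [d c] [d' c']; split=> [x [/d|/d']//|v]; exact: IH.
Qed.

Lemma Ck_sub V W k (O O' : set V) (f : V -> W) : O `<=` O' ->
  Ck_on k O' f -> Ck_on k O f.
Proof.
move=> s; elim: k f => [|k IH] f /= => [c x /s/c//|[d c]].
by split=> [x /s/d//|v]; apply: IH.
Qed.

Lemma Ck_cst V W k (O : set V) (w : W) : open O -> Ck_on k O (fun _ => w).
Proof.
move=> oO; elim: k w => [|k IH] w; first by move=> x _; exact: cst_continuous.
by apply: (@Ck_S _ _ _ _ _ (fun _ _ => 0)) => // x _; exact: is_diff_cst.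
Qed.

Lemma Ck_linear V W k (O : set V) (L : {linear V -> W}) : open O ->
  continuous L -> Ck_on k O L.
Proof.
move=> oO cL; case: k => [x _|k]; first exact: cL.
apply: (@Ck_S _ _ _ _ _ (fun _ => L)) => // [x _|v]; last exact: Ck_cst.
by apply: DiffDef; [exact: linear_differentiable | exact: diff_lin].
Qed.

Lemma is_diff_linear_comp V W Z (L : {linear W -> Z}) (f : V -> W) x :
  continuous L -> differentiable f x ->
  is_diff x (fun y => L (f y)) (fun v => L ('d f x v)).
Proof.
move=> cL df; have dL := linear_differentiable (f x) cL.
apply: DiffDef; first exact: (differentiable_comp df dL).
by rewrite (diff_comp df dL) diff_lin.
Qed.

Lemma Ck_linear_comp V W Z k (O : set V) (L : {linear W -> Z}) (f : V -> W) :
  open O -> continuous L -> Ck_on k O f -> Ck_on k O (fun x => L (f x)).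
Proof.
move=> oO cL; elim: k f => [|k IH] f.
  by move=> cf x Ox; apply: continuous_comp; [exact: cf | exact: cL].
move=> [df Cf]; apply: (@Ck_S _ _ _ _ _ (fun x v => L ('d f x v))) => // [x Ox|v].
  exact: (is_diff_linear_comp cL (df x Ox)).
exact: (IH _ (Cf v)).
Qed.

Lemma is_diff_add V W (f g : V -> W) (df dg : V -> W) x :
  is_diff x f df -> is_diff x g dg ->
  is_diff x (fun y => f y + g y) (fun v => df v + dg v).
Proof. by move=> hf hg; exact: (is_diffD hf hg). Qed.

Lemma Ck_add V W k (O : set V) (f g : V -> W) : open O ->
  Ck_on k O f -> Ck_on k O g -> Ck_on k O (fun x => f x + g x).
Proof.
move=> oO; elim: k f g => [|k IH] f g.
  by move=> cf cg x Ox; apply: continuousD; [exact: cf | exact: cg].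
move=> Cf Cg; apply: (@Ck_S _ _ _ _ _ (fun x v => 'd f x v + 'd g x v)) => //.
  by move=> x Ox; apply: is_diff_add; apply: (Ck_is_diff _ Ox); eassumption.
by move=> v; exact: (IH _ _ (Ck_d v Cf) (Ck_d v Cg)).
Qed.

Lemma Ck_scale V W k (O : set V) (f : V -> R) (g : V -> W) : open O ->
  Ck_on k O f -> Ck_on k O g -> Ck_on k O (fun x => f x *: g x).
Proof.
move=> oO; elim: k f g => [|k IH] f g.
  move=> cf cg x Ox; apply: cvgZ; [exact: cf | exact: cg].
move=> Cf Cg.
have [[df Cdf] [dg Cdg]] := (Cf, Cg).
apply: (@Ck_S _ _ _ _ _ (fun x v => f x *: 'd g x v + 'd f x v *: g x)) => //.
  by move=> x Ox; apply: is_diff_scale; auto.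
move=> v; apply: (Ck_add oO).
  exact: (IH _ _ (Ck_pred Cf) (Ck_d v Cg)).
exact: (IH _ _ (Ck_d v Cf) (Ck_pred Cg)).
Qed.

Lemma Ck_opp V W k (O : set V) (f : V -> W) : open O ->
  Ck_on k O f -> Ck_on k O (fun x => - f x).
Proof.
move=> oO Cf; apply: (@Ck_ext _ _ _ _ (fun x => (-1) *: f x)) => //.
  by move=> x _; rewrite scaleN1r.
by apply: Ck_scale => //; exact: Ck_cst.
Qed.

Lemma Ck_sum V W k (O : set V) n (F : 'I_n -> V -> W) : open O ->
  (forall i, Ck_on k O (F i)) -> Ck_on k O (fun x => \sum_i F i x).
Proof.
move=> oO CF; elim: (index_enum _) => [|i s IH].
  apply: (@Ck_ext _ _ _ _ (fun _ => 0)) => // [x _|]; first by rewrite big_nil.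
  exact: Ck_cst.
apply: (@Ck_ext _ _ _ _ (fun x => F i x + \sum_(j <- s) F j x)) => //.
  by move=> x _; rewrite big_cons.
exact: Ck_add.
Qed.

Lemma is_diff_sum V W n (F dF : 'I_n -> V -> W) x :
  (forall i, is_diff x (F i) (dF i)) ->
  is_diff x (fun y => \sum_i F i y) (fun v => \sum_i dF i v).
Proof.
move=> HF; elim: (index_enum _) => [|i s IH].
  have -> : (fun y => \sum_(i <- [::]) F i y) = (fun _ : V => 0 : W).
    by apply/funext => y; rewrite big_nil.
  have -> : (fun y => \sum_(i <- [::]) dF i y) = 0.
    by apply/funext => y; rewrite big_nil.
  exact: is_diff_cst.
have -> : (fun y => \sum_(i <- i :: s) F i y) =
    (fun y => F i y + \sum_(i <- s) F i y).
  by apply/funext => y; rewrite big_cons.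
have -> : (fun y => \sum_(i <- i :: s) dF i y) =
    (fun y => dF i y + \sum_(i <- s) dF i y).
  by apply/funext => y; rewrite big_cons.
exact: is_diff_add.
Qed.

Lemma Ck_pair V W Z k (O : set V) (f : V -> W) (g : V -> Z) : open O ->
  Ck_on k O f -> Ck_on k O g -> Ck_on k O (fun x => (f x, g x)).
Proof.
move=> oO; elim: k f g => [|k IH] f g.
  by move=> cf cg x Ox; apply: cvg_pair; [exact: cf | exact: cg].
move=> Cf Cg; have [[df Cdf] [dg Cdg]] := (Cf, Cg).
apply: (@Ck_S _ _ _ _ _ (fun x v => ('d f x v, 'd g x v))) => //.
  by move=> x Ox; apply: is_diff_pair; apply: differentiableP; auto.
by move=> v; exact: (IH _ _ (Ck_d v Cf) (Ck_d v Cg)).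
Qed.

(** Expanding the argument on a basis turns a family of linear maps applied
    to a variable vector into a finite sum of products. *)
Lemma lin_app_sum V W Z (B : fin_basis W) (L : V -> W -> Z) (g : V -> W) y :
  linear (L y) -> L y (g y) = \sum_i bco B i (g y) *: L y (bvec B i).
Proof.
move=> lL; have LD u w : L y (u + w) = L y u + L y w.
  by have := lL 1 u w; rewrite !scale1r.
have L0 : L y 0 = 0.
  by apply: (addrI (L y 0)); rewrite -LD !addr0.
have LZ a u : L y (a *: u) = a *: L y u.
  by have := lL a u 0; rewrite L0 !addr0.
rewrite [in LHS](bcoE B (g y)); elim/big_rec2: _ => // i b a _ <-.
by rewrite LD LZ.
Qed.

(** The product rule for y |-> L_y (g y).  It is used for L_y = 'd f y, where it
    separates the second derivative of f from the derivative of g. *)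
Lemma is_diff_lin_app V W Z (B : fin_basis W) (L : V -> W -> Z) (g : V -> W) x :
  (forall y, linear (L y)) -> (forall w, differentiable (L ^~ w) x) ->
  differentiable g x ->
  is_diff x (fun y => L y (g y))
    (fun u => 'd (L ^~ (g x)) x u + L x ('d g x u)).
Proof.
move=> lL dL dg.
rewrite (_ : (fun y => L y (g y)) =
  (fun y => \sum_i bco B i (g y) *: L y (bvec B i))); last first.
  by apply/funext => y; exact: lin_app_sum.
have h1 : is_diff x (L ^~ (g x))
    (fun u => \sum_i bco B i (g x) *: 'd (L ^~ (bvec B i)) x u).
  rewrite (_ : (L ^~ (g x)) =
    (fun y => \sum_i bco B i (g x) *: L y (bvec B i))); last first.
    by apply/funext => y; exact: (@lin_app_sum V W Z B L (fun=> g x)).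
  by apply: is_diff_sum => i; apply: is_diffZ; exact: differentiableP.
have h2 u : L x ('d g x u) = \sum_i bco B i ('d g x u) *: L x (bvec B i).
  exact: (@lin_app_sum V W Z B L (fun=> 'd g x u)).
apply: (@is_diff_eq _ _ _ _ (fun u => \sum_i
   (bco B i (g x) *: 'd (L ^~ (bvec B i)) x u +
    bco B i ('d g x u) *: L x (bvec B i)))); last first.
  by apply/funext => u; rewrite (is_diff_val h1) h2 big_split.
apply: is_diff_sum => i.
have hb := is_diff_linear_comp (bco_cont B i) dg.
apply: is_diff_eq.
  exact: (is_diff_scale (is_diff_ex hb) (dL (bvec B i))).
by apply/funext => u; rewrite (is_diff_val hb).
Qed.

Lemma Ck_lin_app V W Z (B : fin_basis W) k (O : set V) (L : V -> W -> Z)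
  (g : V -> W) : open O -> (forall y, linear (L y)) ->
  (forall w, Ck_on k O (L ^~ w)) -> Ck_on k O g ->
  Ck_on k O (fun y => L y (g y)).
Proof.
move=> oO lL CL Cg.
apply: (@Ck_ext _ _ _ _ (fun y => \sum_i bco B i (g y) *: L y (bvec B i))) => //.
  by move=> y _; rewrite -lin_app_sum.
apply: (Ck_sum oO) => i; apply: (Ck_scale oO) (CL _).
exact: (Ck_linear_comp oO (bco_cont B i) Cg).
Qed.

Lemma Ck_comp U V W (B : fin_basis V) k (O : set U) (O' : set V)
  (f : V -> W) (g : U -> V) : open O -> open O' ->
  (forall x, O x -> O' (g x)) -> Ck_on k O g -> Ck_on k O' f ->
  Ck_on k O (fun x => f (g x)).
Proof.
move=> oO oO' OO'; elim: k f => [|k IH] f.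
  move=> cg cf x Ox; apply: continuous_comp; first exact: cg.
  by apply: cf; exact: OO'.
move=> Cg Cf; have [[dg Cdg] [df Cdf]] := (Cg, Cf).
apply: (@Ck_S _ _ _ _ _ (fun x v => 'd f (g x) ('d g x v))) => //.
  move=> x Ox; apply: is_diff_comp; apply: differentiableP; first exact: dg.
  by apply: df; exact: OO'.
move=> v; apply: (@Ck_lin_app _ _ _ B _ _ (fun x w => 'd f (g x) w) _ oO).
- by move=> y a u w; rewrite linearP.
- by move=> w; exact: (IH (fun y => 'd f y w) (Ck_pred Cg) (Ck_d w Cf)).
- exact: Ck_d.
Qed.

End Ck.

(** * Symmetry of second derivatives *)

Section Schwarz.
Context {R : realType}.
Implicit Types V W : normedModType R.

Lemma line_is_derive V (f : V -> R) x u (s : R) :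
  differentiable f (x + s *: u) ->
  is_derive s 1 (fun t : R => f (x + t *: u)) ('d f (x + s *: u) u).
Proof.
move=> df.
have dl : is_diff s (fun t : R => x + t *: u) (fun t => t *: u).
  apply: is_diff_eq (is_diff_add (is_diff_cst x s) (is_diff_scalel s u)) _.
  by apply/funext => t; rewrite add0r.
have dc : is_diff s (f \o (fun t : R => x + t *: u))
    ('d f (x + s *: u) \o (fun t => t *: u)).
  by apply: is_diff_comp; exact: differentiableP.
apply: DeriveDef; first by apply: diff_derivable; exact: ex_diff.
rewrite deriveE; last exact: ex_diff.
by rewrite diff_val /= scale1r.
Qed.

(** Two applications of the mean value theorem.  The left side is symmetric
    in u and v, which is what makes the mixed derivatives agree. *)
Lemma second_difference V (f : V -> R) (O : set V) x u v (h : R) : 0 < h ->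
  (forall s t, 0 <= s <= h -> 0 <= t <= h -> O (x + s *: u + t *: v)) ->
  (forall y, O y -> differentiable f y) ->
  (forall y, O y -> differentiable (fun z => 'd f z u) y) ->
  exists s t, [/\ 0 <= s <= h, 0 <= t <= h &
    f (x + h *: u + h *: v) - f (x + h *: u) - f (x + h *: v) + f x =
    'd (fun z => 'd f z u) (x + s *: u + t *: v) v * h * h].
Proof.
move=> h0 HO df dfu.
have hh : 0 <= h <= h by rewrite lexx ltW.
have h00 : (0 : R) <= 0 <= h by apply/andP; split; [exact: lexx | exact: ltW].
pose g s := f (x + h *: v + s *: u) - f (x + s *: u).
have HO0 s : 0 <= s <= h -> O (x + s *: u).
  by move=> sh; have := HO s 0 sh h00; rewrite scale0r addr0.
have HO1 s : 0 <= s <= h -> O (x + h *: v + s *: u).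
  by move=> sh; rewrite addrAC; exact: HO.
have dg s : s \in `[0, h] -> is_derive s 1 g
    ('d f (x + h *: v + s *: u) u - 'd f (x + s *: u) u).
  rewrite in_itv /= => sh.
  by apply: is_deriveB; apply: line_is_derive; apply: df; auto.
pose dg' s := 'd f (x + h *: v + s *: u) u - 'd f (x + s *: u) u.
have cg : {within `[0, h], continuous g}.
  by apply: derivable_within_continuous => s sh; have [] := dg s sh.
have [s sh gs] := @MVT_segment R g dg' 0 h (ltW h0)
  (fun s sh => dg s (subset_itv_oo_cc sh)) cg.
move: (sh); rewrite in_itv /= => sh'.
pose k t := 'd f (x + s *: u + t *: v) u.
have dk t : t \in `[0, h] -> is_derive t 1 k
    ('d (fun z => 'd f z u) (x + s *: u + t *: v) v).
  rewrite in_itv /= => th.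
  apply: (@line_is_derive V (fun z => 'd f z u) (x + s *: u)).
  by apply: dfu; exact: HO.
pose dk' t := 'd (fun z => 'd f z u) (x + s *: u + t *: v) v.
have ck : {within `[0, h], continuous k}.
  by apply: derivable_within_continuous => t th; have [] := dk t th.
have [t th kt] := @MVT_segment R k dk' 0 h (ltW h0)
  (fun t th => dk t (subset_itv_oo_cc th)) ck.
move: th; rewrite in_itv /= => th.
exists s, t; split; [exact: sh' | exact: th | ].
move: kt gs; rewrite /k /g /dk' /dg' !scale0r !addr0 !subr0 [x + s *: u + _]addrAC => -> gs.
by rewrite -gs [x + h *: v + _]addrAC; ring.
Qed.

Lemma schwarz_real V (f : V -> R) (O : set V) x u v : open O -> Ck_on 2 O f ->
  O x -> 'd (fun y => 'd f y u) x v = 'd (fun y => 'd f y v) x u.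
Proof.
move=> oO [df Cdf] Ox.
pose A y := 'd (fun y => 'd f y u) y v.
pose B y := 'd (fun y => 'd f y v) y u.
have cA : {for x, continuous A} by have [_ /(_ v)] := Cdf u; exact.
have cB : {for x, continuous B} by have [_ /(_ u)] := Cdf v; exact.
apply/eqP; rewrite -subr_eq0 -normr_le0; apply/ler_addgt0Pl => e e0; rewrite addr0.
have e2 : 0 < e / 2 by rewrite divr_gt0.
have /cvgrPdist_lt /(_ _ e2) nA := cA.
have /cvgrPdist_lt /(_ _ e2) nB := cB.
have nO : \forall y \near x, O y by exact: open_near oO Ox (fun _ => id).
have /nbhs_ballP [r /= r0 rP] : \forall y \near x, [/\ `|A x - A y| < e / 2,
    `|B x - B y| < e / 2 & O y].
  by move: nA nB nO; apply: filterS3 => y; split.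
(* This step keeps the parallelogram x + [0, h] u + [0, h] v inside the ball
   where both mixed derivatives are close to their values at x. *)
pose h := r / (`|u| + `|v| + 1) / 2.
have d0 : 0 < `|u| + `|v| + 1 by rewrite ltr_wpDl // addr_ge0.
have h0 : 0 < h by rewrite !divr_gt0.
have hb s t u' v' : `|u'| + `|v'| = `|u| + `|v| -> 0 <= s <= h -> 0 <= t <= h ->
    ball x r (x + s *: u' + t *: v').
  move=> uv /andP[s0 sh] /andP[t0 th]; rewrite -ball_normE /= -addrA opprD.
  rewrite addrA subrr add0r normrN.
  apply: le_lt_trans (ler_normD _ _) _; rewrite !normrZ !ger0_norm //.
  apply: (@le_lt_trans _ _ (h * (`|u| + `|v|))).
    by rewrite -uv mulrDr lerD // ler_wpM2r.
  have -> : r = h * (`|u| + `|v| + 1) * 2.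
    by rewrite /h; field; rewrite gt_eqF.
  rewrite -mulrA ltr_pM2l //; move: d0; lra.
have [s [t [sh th E1]]] := @second_difference V f O x u v h h0
  (fun s t sh th => let: And3 _ _ o := rP _ (hb s t u v erefl sh th) in o)
  df (fun y Oy => (Cdf u).1 y Oy).
have [s' [t' [sh' th' E2]]] := @second_difference V f O x v u h h0
  (fun s t sh th => let: And3 _ _ o := rP _ (hb s t v u (addrC _ _) sh th) in o)
  df (fun y Oy => (Cdf v).1 y Oy).
have EAB : A (x + s *: u + t *: v) = B (x + s' *: v + t' *: u).
  have h2 : h * h != 0 by rewrite mulf_neq0 // gt_eqF.
  apply: (mulIf h2); rewrite !(mulrA _ h h).
  apply: (etrans (esym E1)); apply: etrans E2.
  by rewrite [x + h *: v + _]addrAC; ring.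
have [a1 _ _] := rP _ (hb s t u v erefl sh th).
have [_ b1 _] := rP _ (hb s' t' v u (addrC _ _) sh' th').
rewrite -/(A x) -/(B x).
have -> : A x - B x = (A x - A (x + s *: u + t *: v)) -
   (B x - B (x + s' *: v + t' *: u)) by rewrite EAB; ring.
apply: le_trans (ler_normB _ _) _; move: a1 b1; lra.
Qed.

(** Coordinates reduce the vector-valued case to [schwarz_real]. *)
Lemma schwarz V W (B : fin_basis W) (f : V -> W) (O : set V) x u v :
  open O -> Ck_on 2 O f -> O x ->
  'd (fun y => 'd f y u) x v = 'd (fun y => 'd f y v) x u.
Proof.
move=> oO Cf Ox; have [df Cdf] := Cf.
rewrite [LHS](bcoE B) [RHS](bcoE B); apply: eq_bigr => i _; congr (_ *: _).
have cb := bco_cont B i.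
have E a b : bco B i ('d (fun y => 'd f y a) x b) =
    'd (fun y => 'd (fun z => bco B i (f z)) y a) x b.
  have d1 := is_diff_linear_comp cb ((Cdf a).1 x Ox).
  apply/esym; apply: (is_diff_near_val b _ d1).
  apply: (open_near oO Ox) => y Oy.
  by rewrite (is_diff_val (is_diff_linear_comp cb (df y Oy))).
by rewrite !E; apply: (@schwarz_real _ _ O) => //; exact: Ck_linear_comp.
Qed.

End Schwarz.

(** * Bump functions *)

Section Flat.
Context {R : realType}.

(** The functions t^-k exp(-1/t), extended by 0.  The family is closed under
    differentiation: the derivative of [flat k] is [flat k.+2] - k [flat k.+1].
    So a single induction gives the smoothness of exp(-1/t). *)
Definition flat (k : nat) (t : R) : R :=
  if 0 < t then t^-1 ^+ k * expR (- t^-1) else 0.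

Lemma flat_gt0 k t : 0 < t -> 0 < flat k t.
Proof. by move=> t0; rewrite /flat t0 mulr_gt0 ?expR_gt0 // exprn_gt0 ?invr_gt0. Qed.

(** From 1 + s^m / m! <= exp s with s = 1/t and m = k + 2.  The quadratic bound
    makes the derivative at 0 vanish. *)
Lemma flat_le k t : `|flat k t| <= (k.+2)`!%:R * t ^+ 2.
Proof.
have F0 : 0 < (k.+2)`!%:R :> R by rewrite ltr0n fact_gt0.
rewrite /flat; case: ifPn => t0; last first.
  by rewrite normr0 mulr_ge0 ?sqr_ge0 // ltW.
have t' : 0 < t^-1 by rewrite invr_gt0.
rewrite ger0_norm; last by apply: mulr_ge0; [exact: (exprn_ge0 _ (ltW t')) | exact: expR_ge0].
rewrite expRN -ler_pdivlMr ?invr_gt0 ?expR_gt0 // invrK.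
have := @expR_ge1Dxn R t^-1 k.+1 (ltW t') => H.
have H' : t^-1 ^+ k.+2 / (k.+2)`!%:R <= expR t^-1.
  by apply: le_trans H; rewrite lerDr.
have : (k.+2)`!%:R * t ^+ 2 * (t^-1 ^+ k.+2 / (k.+2)`!%:R) <=
    (k.+2)`!%:R * t ^+ 2 * expR t^-1.
  by apply: ler_wpM2l => //; apply: mulr_ge0; [exact: ltW | exact: sqr_ge0].
apply: le_trans; rewrite le_eqVlt; apply/orP; left; apply/eqP.
rewrite -addn2 exprD; field.
by rewrite !gt_eqF.
Qed.

Lemma is_diff_of_derive (f : R -> R) (t d : R) :
  is_derive t 1 f d -> is_diff t f (fun v => v * d).
Proof.
move=> H; have df : differentiable f t.
  by apply/derivable1_diffP; exact: ex_derive.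
apply: DiffDef => //; apply/funext => v.
have -> : v = v *: (1 : R) by rewrite /GRing.scale /= mulr1.
rewrite linearZ /= -deriveE // derive_val /GRing.scale /= mulr1 //.
Qed.

Lemma flat_is_diff k t :
  is_diff t (flat k) (fun v => v * (flat k.+2 t - k%:R * flat k.+1 t)).
Proof.
have [t0|t0|<-] := ltgtP 0 t.
- have tn : t != 0 by rewrite gt_eqF.
  have di : is_derive t 1 (fun s : R => s^-1) (- t ^- 2 *: 1).
    exact: is_deriveV tn (is_derive_id t 1).
  have d1 : is_diff t (fun s : R => s^-1) (fun v => v * - t ^- 2).
    by apply: is_diff_of_derive; move: di; rewrite /GRing.scale /= mulr1.
  have d2 : is_diff t (fun s : R => s^-1 ^+ k)
      (fun v => (k%:R * t^-1 ^+ k.-1) * (v * - t ^- 2)).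
    case: (k) => [|j].
      by apply: is_diff_ext (is_diff_cst (1 : R) t) => v //; rewrite !mul0r.
    by apply: is_diff_ext (@is_diffX R R _ _ j t d1) => v //; rewrite exprfctE.
  have d3 : is_diff t (expR \o (fun s : R => - s^-1))
      ((fun v => v * expR (- t^-1)) \o (fun v => - (v * - t ^- 2))).
    have dN : is_diff t (fun s : R => - s^-1) (fun v => - (v * - t ^- 2)).
      exact: (is_diffN d1).
    have dE := is_diff_of_derive (is_derive_expR (- t^-1)).
    exact: (is_diff_comp dN dE).
  have d4 := is_diff_scale (is_diff_ex d2)
    (is_diff_ex d3).
  have near0 : \forall s \near t,
      (s^-1 ^+ k) *: (expR \o (fun s : R => - s^-1)) s = flat k s.
    have : \forall s \near t, 0 < s by exact: lt_nbhsr.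
    by apply: filterS => s s0; rewrite /flat s0.
  apply: is_diff_ext (is_diff_near near0 d4) => // v.
  rewrite (is_diff_val d2) (is_diff_val d3) /flat t0 /GRing.scale /= !exprS.
  case: k {d2 d3 d4 near0} => [|k] /=.
    by rewrite !expr0; field.
  by rewrite exprS; field.
- have near0 : \forall s \near t, (cst 0 : R -> R) s = flat k s.
    have : \forall s \near t, s < 0 by exact: lt_nbhsl.
    by apply: filterS => s s0; rewrite /flat ltNge (ltW s0).
  apply: is_diff_ext (is_diff_near near0 (is_diff_cst (0 : R) t)) => // v.
  by rewrite /flat ltNge (ltW t0) /= mulr0 subr0 mulr0.
have f0 j : flat j 0 = 0 by rewrite /flat ltxx.
rewrite !f0 mulr0 subr0.
have -> : (fun v : R => v * 0) = cst 0 by apply/funext => v; rewrite mulr0.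
have o : flat k \o shift 0 = cst (flat k 0) + (\0 : R -> R) +o_ 0 id.
  apply/eqaddoP => e e0; rewrite f0.
  have F0 : 0 < (k.+2)`!%:R :> R by rewrite ltr0n fact_gt0.
  have : \forall y \near (0 : R), `|y| < e / (k.+2)`!%:R.
    by apply: nbhs0_lt; rewrite divr_gt0.
  apply: filterS => y ye; rewrite !fctE /= addr0 add0r subr0.
  apply: le_trans (flat_le _ _) _; rewrite -real_normK ?num_real // expr2 mulrA.
  by rewrite ler_wpM2r // mulrC -ler_pdivlMr // ltW.
have dE : 'd (flat k) 0 = (\0 : R -> R) :> (R -> R).
  by apply: diff_unique o; exact: cst_continuous.
apply: DiffDef; last exact: dE.
by apply/diff_locallyP; split; rewrite dE; [exact: cst_continuous|].
Qed.

Lemma Ck_flat m k : Ck_on m setT (flat k).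
Proof.
elim: m k => [|m IH] k.
  move=> t _; apply: differentiable_continuous.
  exact: is_diff_ex (flat_is_diff k t).
apply: (Ck_S openT (fun t _ => flat_is_diff k t)) => v.
apply: (Ck_scale (f := fun _ => v) openT (Ck_cst _ _ openT)).
apply: (Ck_add openT (IH _)); apply: (Ck_opp openT).
exact: (Ck_scale (f := fun _ => k%:R) openT (Ck_cst _ _ openT) (IH _)).
Qed.

(** The bump is exp(-1/t), normalized, at t = r^2/4 minus the squared Euclidean
    distance to c, where U contains the ball of radius r; the compact set K is a
    cube around c. *)
Lemma bump_rV n (U : set 'rV[R]_n) (c : 'rV[R]_n) : open U -> U c ->
  exists rho : 'rV[R]_n -> R, exists K : set 'rV[R]_n,
    [/\ forall k, Ck_on k setT rho, rho c = 1, compact K, K `<=` U &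
        forall x, ~ K x -> rho x = 0].
Proof.
move=> oU Uc.
have /nbhs_ballP [r /= r0 rU] := open_nbhs_nbhs (conj oU Uc).
pose q (x : 'rV[R]_n) : R := \sum_i ((x 0 i - c 0 i) *: (x 0 i - c 0 i) : R).
pose e := (r / 2) ^+ 2.
have r2 : 0 < r / 2 by rewrite divr_gt0.
have e0 : 0 < e by rewrite exprn_gt0.
pose K := [set x : 'rV[R]_n | forall i,
  ([set` `[c 0 i - r / 2, c 0 i + r / 2]] : set R) (x ord0 i)].
pose rho x := (flat 0 e)^-1 *: flat 0 (e - q x).
have f0 : 0 < flat 0 e by exact: flat_gt0.
have qc : q c = 0 by rewrite /q big1 // => i _; rewrite subrr scaler0.
exists rho, K; split.
- move=> k; apply: (Ck_scale (f := fun _ => _) openT (Ck_cst _ _ openT)).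
  apply: (Ck_comp real_basis openT openT (fun _ _ => I) _ (Ck_flat _ _)).
  apply: (Ck_add openT (Ck_cst _ _ openT)); apply: (Ck_opp openT).
  have Cl i : Ck_on k setT (fun x : 'rV[R]_n => x 0 i - c 0 i).
    have Ci : Ck_on k setT (fun x : 'rV[R]_n => x 0 i : R).
      exact: (Ck_linear k openT (bco_cont (rV_basis n) i)).
    exact: (Ck_add openT Ci (Ck_cst k (- c 0 i) openT)).
  apply: (Ck_sum openT) => i; exact: (Ck_scale openT (Cl i) (Cl i)).
- by rewrite /rho qc subr0 /GRing.scale /= mulVf // gt_eqF.
- exact: (@rV_compact R n
    (fun i => [set` `[c 0 i - r / 2, c 0 i + r / 2]] : set R)
    (fun i => @segment_compact R _ _)).
- move=> x Kx; apply: rU; split=> // i j; rewrite (ord1 i).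
  have := Kx j; rewrite /= in_itv /= => /andP[h1 h2].
  rewrite -ball_normE /= ltr_norml; apply/andP; split; move: r0 h1 h2; lra.
- move=> x nK; have [i xi] : exists i, (r / 2) ^+ 2 <= (x 0 i - c 0 i) ^+ 2.
    apply: contrapT => /forallNP H; apply: nK => i /=; rewrite in_itv /=.
    have /negP := H i; rewrite -ltNge => lt1.
    have : `|x 0 i - c 0 i| < r / 2.
      rewrite ltNge; apply/negP => le2; move: lt1; apply/negP; rewrite -leNgt.
      by rewrite -[leRHS]real_normK ?num_real // ler_sqr ?nnegrE // ltW.
    by rewrite ltr_norml => /andP[h1 h2]; apply/andP; split; move: h1 h2; lra.
  have qe : e <= q x.
    rewrite /q (bigD1 i) //=; apply: (le_trans xi); rewrite expr2 lerDl.
    by apply: sumr_ge0 => j _; exact: sqr_ge0.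
  have f0x : flat 0 (e - q x) = 0 by rewrite /flat subr_gt0 ltNge qe.
  by rewrite /rho f0x scaler0.
Qed.

End Flat.

(** * Vector fields in an atlas *)

Definition overlap (V T : Type) (N : atlas V T) (a b : chart_index N) : set V :=
  coord a @` (dom a `&` dom b).

(** What calculus on fields needs from an atlas; no topology on T is involved,
    so that it applies to the slit bundle as a bare set. *)
Record smooth_atlas (R : realType) (V : normedModType R) (T : Type)
    (N : atlas V T) : Prop := {
  dom_chart_at : forall p, dom (chart_at N p) p;
  coord_inj : forall (a : chart_index N) p q, dom a p -> dom a q ->
    coord a p = coord a q -> p = q;
  open_overlap : forall a b : chart_index N, open (overlap a b);
  smooth_transition : forall a b : chart_index N,
    smooth_on (overlap a b) (transition a b)
}.

Lemma loc_inj (R : realType) (V W : normedModType R) (T : Type)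
    (N : atlas V T) (f : T -> W) (a : chart_index N) p :
  (forall q, dom a q -> dom a p -> coord a q = coord a p -> q = p) ->
  dom a p -> loc f a (coord a p) = f p.
Proof.
move=> inj ap; apply: xget_unique; first by exists p.
by move=> _ [q /= [aq qp] <-]; rewrite (inj q aq ap qp).
Qed.

Section Atlas.
Context {R : realType} {V : normedModType R} {T : Type} {N : atlas V T}.
Variable (B : fin_basis V) (sN : smooth_atlas N).
Implicit Types (a b c : chart_index N) (W : normedModType R) (p q : T)
  (X Y Z : T -> V) (f g : T -> R).

Let inN p : dom (chart_at N p) p := dom_chart_at sN p.

Lemma locE W (f : T -> W) a p : dom a p -> loc f a (coord a p) = f p.
Proof. by move=> ap; apply: loc_inj => // q aq; exact: coord_inj. Qed.

#[local] Opaque loc.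

Lemma coord_dom_in a p : dom a p -> coord_dom a (coord a p).
Proof. by move=> ap; exists p. Qed.

Lemma overlap_in a b p : dom a p -> dom b p -> overlap a b (coord a p).
Proof. by move=> ap bp; exists p. Qed.

Lemma open_coord_dom a : open (coord_dom a).
Proof.
have -> : coord_dom a = overlap a a by rewrite /overlap setIid.
exact: open_overlap.
Qed.

Lemma near_coord a b p (P : V -> Prop) : dom a p -> dom b p ->
  (forall q, dom a q -> dom b q -> P (coord a q)) -> \forall x \near coord a p, P x.
Proof.
move=> ap bp H; apply: (open_near (open_overlap sN a b)); first exact: overlap_in.
by move=> _ [q [aq bq] <-]; exact: H.
Qed.

Lemma transitionE a b p : dom a p -> transition a b (coord a p) = coord b p.
Proof. exact: locE. Qed.

Lemma change0 a b p : change a b p 0 = 0.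
Proof. exact: linear0. Qed.

Lemma changeZ a b p (k : R) u : change a b p (k *: u) = k *: change a b p u.
Proof. exact: linearZ. Qed.

Lemma transition_diff a b p : dom a p -> dom b p ->
  differentiable (transition a b) (coord a p).
Proof.
move=> ap bp; have [df _] := smooth_transition sN a b 1.
exact: df (overlap_in ap bp).
Qed.

Lemma change_trans a b c p u : dom a p -> dom b p -> dom c p ->
  change b c p (change a b p u) = change a c p u.
Proof.
move=> ap bp cp; have dab := transition_diff ap bp.
have dbc := transition_diff bp cp.
have e : coord b p = transition a b (coord a p) by rewrite /transition locE.
rewrite /change e in dbc *.
have h := is_diff_comp (differentiableP dab) (differentiableP dbc).
apply/esym; apply: (is_diff_near_val u _ h).
apply: (near_coord ap bp) => q aq bq /=.
by rewrite /transition locE // locE // locE.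
Qed.

Lemma change_id a p u : dom a p -> change a a p u = u.
Proof.
move=> ap; apply: (is_diff_near_val u _ (is_diff_id (coord a p))).
by apply: (near_coord ap ap) => q aq _; rewrite /transition locE.
Qed.

Lemma change_inj a b p u w : dom a p -> dom b p ->
  change a b p u = change a b p w -> u = w.
Proof.
move=> ap bp e; rewrite -(change_id u ap) -(change_trans u ap bp ap) e.
by rewrite (change_trans w ap bp ap) change_id.
Qed.

Lemma vrepE X a p : dom a p ->
  vrep X a (coord a p) = change (chart_at N p) a p (X p).
Proof. exact: locE. Qed.

Lemma vrep_chart_at X p : vrep X (chart_at N p) (coord (chart_at N p) p) = X p.
Proof. by rewrite vrepE // change_id. Qed.

Lemma vrep_change X a b p : dom a p -> dom b p ->
  vrep X b (coord b p) = change a b p (vrep X a (coord a p)).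
Proof. by move=> ap bp; rewrite !vrepE // change_trans. Qed.

(** The chain rule for the change of charts. *)
Lemma loc_change W (f : T -> W) a b p u : dom a p -> dom b p ->
  differentiable (loc f b) (coord b p) ->
  'd (loc f a) (coord a p) u = 'd (loc f b) (coord b p) (change a b p u).
Proof.
move=> ap bp df; have dab := transition_diff ap bp.
have e : coord b p = transition a b (coord a p) by rewrite /transition locE.
rewrite /change e in df *.
have h := is_diff_comp (differentiableP dab) (differentiableP df).
apply: (is_diff_near_val u _ h).
apply: (near_coord ap bp) => q aq bq /=.
by rewrite /transition !locE.
Qed.

Lemma smooth_fun_diff f a p : smooth_fun N f -> dom a p ->
  differentiable (loc f a) (coord a p).
Proof. by move=> sf ap; have [df _] := sf a 1; exact: df (coord_dom_in ap). Qed.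

Lemma smooth_vf_diff X a p : smooth_vf N X -> dom a p ->
  differentiable (vrep X a) (coord a p).
Proof. by move=> sX ap; have [df _] := sX a 1; exact: df (coord_dom_in ap). Qed.

Lemma lie_fun_chart X f a p : smooth_fun N f -> dom a p ->
  lie_fun N X f p = 'd (loc f a) (coord a p) (vrep X a (coord a p)).
Proof.
move=> sf ap; rewrite /lie_fun /dfun.
rewrite (loc_change _ (inN p) ap (smooth_fun_diff sf ap)).
by rewrite (vrep_change X (inN p) ap) vrep_chart_at.
Qed.

Lemma lie_fun_loc X f a x : smooth_fun N f -> coord_dom a x ->
  loc (lie_fun N X f) a x = 'd (loc f a) x (vrep X a x).
Proof. by move=> sf [p ap <-]; rewrite locE // -lie_fun_chart. Qed.

Lemma smooth_lie_fun X f : smooth_vf N X -> smooth_fun N f ->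
  smooth_fun N (lie_fun N X f).
Proof.
move=> sX sf a k; have oa := open_coord_dom a.
apply: (@Ck_ext _ _ _ _ _ (fun x => 'd (loc f a) x (vrep X a x)) _ oa).
  by move=> x ax; rewrite lie_fun_loc.
apply: (Ck_lin_app B (L := fun x => 'd (loc f a) x) oa _ _ (sX a k)).
  by move=> y; exact: linearP.
by move=> w; exact: (Ck_d w (sf a k.+1)).
Qed.

(** The bracket is defined with the chart chosen at each point; here it is shown
    to have the same expression in every chart.  In the change of charts the
    two second derivatives of the transition map cancel by [schwarz]. *)
Lemma vrep_bracket X Y a x : smooth_vf N X -> smooth_vf N Y -> coord_dom a x ->
  vrep (bracket N X Y) a x =
  'd (vrep Y a) x (vrep X a x) - 'd (vrep X a) x (vrep Y a x).
Proof.
move=> sX sY [p ap <-].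
set b := chart_at N p; set phi := transition b a; set y := coord b p.
have bp : dom b p by exact: inN.
have e : coord a p = phi y by rewrite /phi /transition locE.
(* Differentiating Y_a (phi y) = 'd phi y (Y_b y) along X. *)
have key X' Y' : smooth_vf N X' -> smooth_vf N Y' ->
    'd (vrep Y' a) (coord a p) (vrep X' a (coord a p)) =
    'd (fun z => 'd phi z (vrep Y' b y)) y (vrep X' b y) +
    'd phi y ('d (vrep Y' b) y (vrep X' b y)).
  move=> sX' sY'.
  have d1 : is_diff y (fun z => 'd phi z (vrep Y' b z)) (fun u =>
     'd (fun z => 'd phi z (vrep Y' b y)) y u + 'd phi y ('d (vrep Y' b) y u)).
    apply: (is_diff_lin_app B (L := fun z => 'd phi z)).
    - by move=> z; exact: linearP.
    - move=> w; have [df _] := Ck_d w (smooth_transition sN b a 2).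
      by apply: df; exact: overlap_in.
    - exact: smooth_vf_diff.
  have d2 : is_diff y (vrep Y' a \o phi) ('d (vrep Y' a) (phi y) \o 'd phi y).
    apply: is_diff_comp; first exact: differentiableP (transition_diff bp ap).
    by apply: differentiableP; rewrite -e; exact: smooth_vf_diff.
  have n : \near y, 'd phi y (vrep Y' b y) = (vrep Y' a \o phi) y.
    apply: (near_coord bp ap) => q bq aq /=.
    by rewrite {2}/phi /transition locE // (vrep_change Y' bq aq).
  rewrite (vrep_change X' bp ap) /change -/phi -/y e.
  exact: etrans (esym (is_diff_app (vrep X' b y) d2))
    (is_diff_near_val (vrep X' b y) n d1).
rewrite !key // vrepE // /bracket -/b -/y /change -/phi linearB.
rewrite !vrep_chart_at.
rewrite (@schwarz _ _ _ B phi (overlap b a) y (X p) (Y p)).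
- by rewrite opprD addrACA subrr add0r.
- exact: open_overlap.
- exact: smooth_transition.
- exact: overlap_in.
Qed.

Lemma smooth_bracket X Y : smooth_vf N X -> smooth_vf N Y ->
  smooth_vf N (bracket N X Y).
Proof.
move=> sX sY a k; have oa := open_coord_dom a.
apply: (@Ck_ext _ _ _ _ _ (fun x => 'd (vrep Y a) x (vrep X a x) -
   'd (vrep X a) x (vrep Y a x)) _ oa).
  by move=> x ax; rewrite vrep_bracket.
have key X' Y' : smooth_vf N X' -> smooth_vf N Y' ->
    Ck_on k (coord_dom a) (fun x => 'd (vrep Y' a) x (vrep X' a x)).
  move=> sX' sY'.
  apply: (Ck_lin_app B (L := fun x => 'd (vrep Y' a) x) oa _ _ (sX' a k)).
    by move=> y; exact: linearP.
  by move=> w; exact: (Ck_d w (sY' a k.+1)).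
exact: (Ck_add oa (key _ _ sX sY) (Ck_opp oa (key _ _ sY sX))).
Qed.

Lemma vrepD X Y a x : coord_dom a x -> vrep (X + Y) a x = vrep X a x + vrep Y a x.
Proof. by move=> [p ap <-]; rewrite !vrepE // /change linearD. Qed.

Lemma vrepZ (k : R) X a x : coord_dom a x -> vrep (k *: X) a x = k *: vrep X a x.
Proof. by move=> [p ap <-]; rewrite !vrepE // /change linearZ. Qed.

Lemma smooth_vfD X Y : smooth_vf N X -> smooth_vf N Y -> smooth_vf N (X + Y).
Proof.
move=> sX sY a k; have oa := open_coord_dom a.
apply: (Ck_ext oa _ (Ck_add oa (sX a k) (sY a k))) => x ax.
by rewrite vrepD.
Qed.

Lemma smooth_vfZ (k : R) X : smooth_vf N X -> smooth_vf N (k *: X).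
Proof.
move=> sX a m; have oa := open_coord_dom a.
apply: (Ck_ext oa _ (Ck_scale oa (Ck_cst m k oa) (sX a m))) => x ax.
by rewrite vrepZ.
Qed.

Lemma smooth_vfN X : smooth_vf N X -> smooth_vf N (- X).
Proof. by rewrite -scaleN1r; exact: smooth_vfZ. Qed.

Lemma smooth_vfB X Y : smooth_vf N X -> smooth_vf N Y -> smooth_vf N (X - Y).
Proof. by move=> sX sY; apply: smooth_vfD => //; exact: smooth_vfN. Qed.

Lemma smooth_funD f g : smooth_fun N f -> smooth_fun N g -> smooth_fun N (f + g).
Proof.
move=> sf sg a k; have oa := open_coord_dom a.
apply: (Ck_ext oa _ (Ck_add oa (sf a k) (sg a k))) => _ [p ap <-].
by rewrite !locE.
Qed.

Lemma smooth_funZ (k : R) f : smooth_fun N f -> smooth_fun N (k *: f).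
Proof.
move=> sf a m; have oa := open_coord_dom a.
apply: (Ck_ext oa _ (Ck_scale oa (Ck_cst m k oa) (sf a m))) => _ [p ap <-].
by rewrite !locE.
Qed.

Lemma smooth_funN f : smooth_fun N f -> smooth_fun N (- f).
Proof. by rewrite -scaleN1r; exact: smooth_funZ. Qed.

Lemma smooth_funB f g : smooth_fun N f -> smooth_fun N g -> smooth_fun N (f - g).
Proof. by move=> sf sg; apply: smooth_funD => //; exact: smooth_funN. Qed.

Lemma bracketDr X Y Z : smooth_vf N X -> smooth_vf N Y -> smooth_vf N Z ->
  bracket N X (Y + Z) = bracket N X Y + bracket N X Z.
Proof.
move=> sX sY sZ; apply/funext => p.
set a := chart_at N p; have ap : dom a p by exact: inN.
have bE X' Y' : bracket N X' Y' p =
    'd (vrep Y' a) (coord a p) (X' p) - 'd (vrep X' a) (coord a p) (Y' p) by [].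
have dY := smooth_vf_diff sY ap.
have dZ := smooth_vf_diff sZ ap.
have h := is_diff_add (differentiableP dY) (differentiableP dZ).
have n : \forall x \near coord a p, vrep Y a x + vrep Z a x = vrep (Y + Z) a x.
  apply: (open_near (open_coord_dom a) (coord_dom_in ap)) => x ax.
  by rewrite vrepD.
have e := is_diff_near_val (X p) n h.
rewrite fctE. rewrite !bE. 
rewrite e. 
rewrite fctE. 
rewrite linearD. 
rewrite opprD addrACA.
by [].
Qed.

Lemma bracketC X Y : bracket N X Y = - bracket N Y X.
Proof. by apply/funext => p; rewrite /bracket fctE opprB. Qed.

Lemma bracketDl X Y Z : smooth_vf N X -> smooth_vf N Y -> smooth_vf N Z ->
  bracket N (X + Y) Z = bracket N X Z + bracket N Y Z.
Proof.
by move=> sX sY sZ; rewrite bracketC bracketDr // opprD -!bracketC.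
Qed.

Lemma bracketNr X Y : smooth_vf N X -> smooth_vf N Y ->
  bracket N X (- Y) = - bracket N X Y.
Proof.
move=> sX sY; have sN' := smooth_vfN sY.
apply/eqP; rewrite -addr_eq0 -bracketDr // addNr.
apply/eqP; apply: (addrI (bracket N X 0)).
rewrite -bracketDr ?addr0 //; rewrite -(subrr Y); exact: smooth_vfB.
Qed.

Lemma bracketNl X Y : smooth_vf N X -> smooth_vf N Y ->
  bracket N (- X) Y = - bracket N X Y.
Proof. by move=> sX sY; rewrite bracketC bracketNr // -bracketC. Qed.

Lemma bracketBr X Y Z : smooth_vf N X -> smooth_vf N Y -> smooth_vf N Z ->
  bracket N X (Y - Z) = bracket N X Y - bracket N X Z.
Proof.
by move=> sX sY sZ; rewrite bracketDr ?bracketNr //; exact: smooth_vfN.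
Qed.

Lemma bracketBl X Y Z : smooth_vf N X -> smooth_vf N Y -> smooth_vf N Z ->
  bracket N (X - Y) Z = bracket N X Z - bracket N Y Z.
Proof.
by move=> sX sY sZ; rewrite bracketDl ?bracketNl //; exact: smooth_vfN.
Qed.

Lemma lie_funD X f g : smooth_fun N f -> smooth_fun N g ->
  lie_fun N X (f + g) = lie_fun N X f + lie_fun N X g.
Proof.
move=> sf sg; apply/funext => p; rewrite /lie_fun /dfun fctE.
set a := chart_at N p; have ap : dom a p by exact: inN.
have h := is_diff_add (differentiableP (smooth_fun_diff sf ap))
  (differentiableP (smooth_fun_diff sg ap)).
have n : \forall x \near coord a p, loc f a x + loc g a x =
    loc (f + g) a x.
  apply: (open_near (open_coord_dom a) (coord_dom_in ap)) => _ [q aq <-].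
  by rewrite !locE.
by rewrite (is_diff_val (is_diff_near n h)).
Qed.

Lemma lie_funN X f : smooth_fun N f -> lie_fun N X (- f) = - lie_fun N X f.
Proof.
move=> sf; have sN' := smooth_funN sf.
apply/eqP; rewrite -addr_eq0 -lie_funD // addNr.
apply/eqP; apply: (addrI (lie_fun N X 0)).
rewrite -lie_funD ?addr0 //; rewrite -(subrr f); exact: smooth_funB.
Qed.

Lemma lie_funB X f g : smooth_fun N f -> smooth_fun N g ->
  lie_fun N X (f - g) = lie_fun N X f - lie_fun N X g.
Proof.
by move=> sf sg; rewrite lie_funD ?lie_funN //; exact: smooth_funN.
Qed.

Lemma lie_funDl X Y f : lie_fun N (X + Y) f = lie_fun N X f + lie_fun N Y f.
Proof. by apply/funext => p; rewrite /lie_fun /dfun !fctE linearD. Qed.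

Lemma lie_funNl X f : lie_fun N (- X) f = - lie_fun N X f.
Proof. by apply/funext => p; rewrite /lie_fun /dfun !fctE linearN. Qed.

Lemma lie_funBl X Y f : lie_fun N (X - Y) f = lie_fun N X f - lie_fun N Y f.
Proof. by rewrite lie_funDl lie_funNl. Qed.

(** Depends on the chart chosen at p; only the combinations in [bracketE] and
    [lie_fun_lie_fun] are intrinsic. *)
Definition dfield X p u : V :=
  'd (vrep X (chart_at N p)) (coord (chart_at N p) p) u.

(** Depends on the chart chosen at p, as [dfield] does. *)
Definition hessian f p u w : R :=
  'd (fun x => 'd (loc f (chart_at N p)) x w) (coord (chart_at N p) p) u.

Lemma is_diff_vrep X p (a := chart_at N p) : smooth_vf N X ->
  is_diff (coord a p) (vrep X a) (dfield X p).
Proof.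
move=> sX; apply: DiffDef; first exact: smooth_vf_diff sX (inN p).
by apply/funext => u.
Qed.

Lemma is_diff_dloc f p w (a := chart_at N p) : smooth_fun N f ->
  is_diff (coord a p) (fun x => 'd (loc f a) x w) (fun u => hessian f p u w).
Proof.
move=> sf; apply: DiffDef.
  by have [d _] := Ck_d w (sf a 2); exact: d (coord_dom_in (inN p)).
by apply/funext => u.
Qed.

Lemma dfield_near X p u (g dg : V -> V) (a := chart_at N p) :
  (forall x, coord_dom a x -> g x = vrep X a x) -> is_diff (coord a p) g dg ->
  dfield X p u = dg u.
Proof.
move=> gX dgp; apply: (is_diff_near_val u _ dgp).
by apply: (open_near (open_coord_dom a) (coord_dom_in (inN p))) => x; exact: gX.
Qed.

Lemma dfield0 p u : dfield 0 p u = 0.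
Proof.
apply: (dfield_near u (g := cst 0) _ (is_diff_cst _ _)) => _ [q aq <-].
by rewrite vrepE // change0.
Qed.

Lemma hessianDl f p u u' w :
  hessian f p (u + u') w = hessian f p u w + hessian f p u' w.
Proof. exact: linearD. Qed.

Lemma hessianZl f p k u w : hessian f p (k *: u) w = k * hessian f p u w.
Proof. exact: linearZ. Qed.

(** Differentiating 'd f (X) produces the second derivative of f and the
    derivative of X. *)
Lemma diff_lie_fun X f p u (a := chart_at N p) : smooth_vf N X -> smooth_fun N f ->
  'd (loc (lie_fun N X f) a) (coord a p) u =
  'd (fun x => 'd (loc f a) x (X p)) (coord a p) u +
  'd (loc f a) (coord a p) ('d (vrep X a) (coord a p) u).
Proof.
move=> sX sf; have ap : dom a p by exact: inN.
have h := is_diff_lin_app B (L := fun x => 'd (loc f a) x)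
  (fun y => linearP _)
  (fun w => (Ck_d w (sf a 2)).1 _ (coord_dom_in ap)) (smooth_vf_diff sX ap).
have n : \forall x \near coord a p, 'd (loc f a) x (vrep X a x) =
    loc (lie_fun N X f) a x.
  apply: (open_near (open_coord_dom a) (coord_dom_in ap)) => x ax.
  by rewrite lie_fun_loc.
by rewrite (is_diff_val (is_diff_near n h)) vrep_chart_at.
Qed.

Lemma lie_fun_lie_fun X Y f p : smooth_vf N X -> smooth_vf N Y ->
  smooth_fun N f -> lie_fun N X (lie_fun N Y f) p =
  hessian f p (X p) (Y p) + dfun N f p (dfield Y p (X p)).
Proof. by move=> sX sY sf; exact: diff_lie_fun. Qed.

Lemma hessianC f p u w : smooth_fun N f -> hessian f p u w = hessian f p w u.
Proof.
move=> sf; exact: (schwarz_real _ _ (open_coord_dom _) (sf _ 2) (coord_dom_in (inN p))).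
Qed.

Lemma dfunB f p u w : dfun N f p (u - w) = dfun N f p u - dfun N f p w.
Proof. exact: linearB. Qed.

Lemma bracketE X Y p : bracket N X Y p = dfield Y p (X p) - dfield X p (Y p).
Proof. by []. Qed.

(** The second derivatives of f cancel by symmetry. *)
Lemma lie_fun_bracket X Y f : smooth_vf N X -> smooth_vf N Y ->
  smooth_fun N f -> lie_fun N (bracket N X Y) f =
  lie_fun N X (lie_fun N Y f) - lie_fun N Y (lie_fun N X f).
Proof.
move=> sX sY sf; apply/funext => p.
rewrite !fctE (lie_fun_lie_fun p sX sY sf) (lie_fun_lie_fun p sY sX sf).
rewrite (hessianC p (Y p) (X p) sf) opprD addrACA subrr add0r.
by rewrite /lie_fun bracketE dfunB.
Qed.

Lemma diff_bracket X Y p u (a := chart_at N p) : smooth_vf N X -> smooth_vf N Y ->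
  'd (vrep (bracket N X Y) a) (coord a p) u =
  'd (fun x => 'd (vrep Y a) x (X p)) (coord a p) u +
  'd (vrep Y a) (coord a p) ('d (vrep X a) (coord a p) u) -
  ('d (fun x => 'd (vrep X a) x (Y p)) (coord a p) u +
  'd (vrep X a) (coord a p) ('d (vrep Y a) (coord a p) u)).
Proof.
move=> sX sY; have ap : dom a p by exact: inN.
have key X' Y' : smooth_vf N X' -> smooth_vf N Y' ->
    is_diff (coord a p) (fun x => 'd (vrep Y' a) x (vrep X' a x))
    (fun u => 'd (fun x => 'd (vrep Y' a) x (X' p)) (coord a p) u +
      'd (vrep Y' a) (coord a p) ('d (vrep X' a) (coord a p) u)).
  move=> sX' sY'.
  have := is_diff_lin_app B (L := fun x => 'd (vrep Y' a) x)
    (fun y => linearP _)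
    (fun w => (Ck_d w (sY' a 2)).1 _ (coord_dom_in ap)) (smooth_vf_diff sX' ap).
  by rewrite vrep_chart_at.
have h := is_diffB (key _ _ sX sY) (key _ _ sY sX).
have n : \forall x \near coord a p, 'd (vrep Y a) x (vrep X a x) -
    'd (vrep X a) x (vrep Y a x) =
    vrep (bracket N X Y) a x.
  apply: (open_near (open_coord_dom a) (coord_dom_in ap)) => x ax.
  by rewrite vrep_bracket.
by rewrite (is_diff_val (is_diff_near n h)).
Qed.

(** Stated as the derivation property of [X, .].  The second derivatives of the
    components cancel by [schwarz]. *)
Lemma jacobi X Y Z : smooth_vf N X -> smooth_vf N Y -> smooth_vf N Z ->
  bracket N X (bracket N Y Z) =
  bracket N (bracket N X Y) Z + bracket N Y (bracket N X Z).
Proof.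
move=> sX sY sZ; apply/funext => p; rewrite fctE.
set a := chart_at N p; have ap : dom a p by exact: inN.
pose d G u := 'd (vrep G a) (coord a p) u.
pose h G w u := 'd (fun z => 'd (vrep G a) z w) (coord a p) u.
have bE X' Y' : bracket N X' Y' p = d Y' (X' p) - d X' (Y' p) by [].
have dbE X' Y' u : smooth_vf N X' -> smooth_vf N Y' -> d (bracket N X' Y') u =
    h Y' (X' p) u + d Y' (d X' u) - (h X' (Y' p) u + d X' (d Y' u)).
  exact: diff_bracket.
have dB G u v : d G (u - v) = d G u - d G v by exact: linearB.
have S G w u : smooth_vf N G -> h G w u = h G u w.
  move=> sW; exact: (schwarz B _ _ (open_coord_dom a) (sW a 2) (coord_dom_in ap)).
clearbody d h.
apply: (bco_inj (B := B)) => i.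
rewrite (bE X (bracket N Y Z)) (bE (bracket N X Y) Z) (bE Y (bracket N X Z)) !dbE // !bE !dB.
rewrite (S Z (Y p) (X p)) // (S Y (Z p) (X p)) // (S X (Z p) (Y p)) //.
by rewrite !(raddfB, raddfD) /=; ring.
Qed.

(** The field with constant components w in the chart a, cut off by rho.  It
    is smooth on the overlaps with a, and it vanishes off K; these sets cover
    every chart because K is contained in the domain of a. *)
Lemma cutoff_extension a (rho : V -> R) (K : set T) (w : V) :
  (forall k, Ck_on k setT rho) -> K `<=` dom a ->
  (forall q, dom a q -> ~ K q -> rho (coord a q) = 0) ->
  (forall b, open (coord b @` (dom b `\` K))) ->
  exists X, smooth_vf N X /\ forall q, dom a q ->
    X q = rho (coord a q) *: change a (chart_at N q) q w.
Proof.
move=> srho Ka rho0 oK.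
pose X q := if `[< dom a q >] then
  rho (coord a q) *: change a (chart_at N q) q w else 0.
have XE q : dom a q -> X q = rho (coord a q) *: change a (chart_at N q) q w.
  by move=> aq; rewrite /X asboolT.
exists X; split=> // b k.
apply: (@Ck_sub _ _ _ _ _ (overlap b a `|` coord b @` (dom b `\` K))).
  move=> _ [q bq <-]; have [Kq|nKq] := EM (K q); [left|right]; exists q => //.
  by split=> //; exact: Ka.
apply: Ck_union.
- have ob := open_overlap sN b a; have oa := open_overlap sN a b.
  have sba := smooth_transition sN b a k.
  have ba x : overlap b a x -> overlap a b (transition b a x).
    by move=> [q [bq aq] <-]; rewrite /transition locE //; exists q.
  apply: (@Ck_ext _ _ _ _ _ (fun x => rho (transition b a x) *:
    'd (transition a b) (transition b a x) w) _ ob).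
    move=> _ [q [bq aq] <-].
    by rewrite vrepE // XE // changeZ change_trans // !transitionE.
  apply: (Ck_scale ob).
    exact: (Ck_comp B ob openT (fun _ _ => I) sba (srho k)).
  exact: (Ck_comp (f := fun x => 'd (transition a b) x w) B ob oa ba sba
    (Ck_d w (smooth_transition sN a b k.+1))).
- apply: (@Ck_ext _ _ _ _ _ (fun=> 0) _ (oK b)); last exact: Ck_cst.
  move=> _ [q [bq nKq] <-]; rewrite vrepE // /X; case: asboolP => aq.
    by rewrite rho0 // scale0r change0.
  by rewrite change0.
Qed.

End Atlas.

#[local] Opaque loc dfield hessian.

(** * The atlas of the slit tangent bundle *)

Section Slit.
Context {R : realType} {V : normedModType R} {M : Type} {A : atlas V M}.
Variable (B : fin_basis V) (sA : smooth_atlas A).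

Notation N := (slit_atlas A).
Notation base z := (val z).1.
Implicit Types (a b : chart_index A) (z : slitTM V M) (X Y : slitTM V M -> V * V).

Lemma coord_slit a z : coord (a : chart_index N) z =
  (coord a (base z), change (chart_at A (base z)) a (base z) (val z).2).
Proof. by []. Qed.

Lemma change_neq0 a z : dom a (base z) ->
  change (chart_at A (base z)) a (base z) (val z).2 != 0.
Proof.
move=> az; apply/eqP => e; have /negP := valP z; apply; apply/eqP.
by apply: (change_inj sA (dom_chart_at sA _) az); rewrite e change0.
Qed.

(** A change of charts is a linear isomorphism on each fibre, so nonzero
    vectors correspond to nonzero second components. *)
Lemma slit_overlapE a b :
  @overlap _ _ N a b = [set w | overlap a b w.1 /\ w.2 != 0].
Proof.
apply/seteqP; split=> [_ [z [az bz] <-]|[x y] /= [[p [ap bp] <-] y0]].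
  by split; [exists (base z) | exact: change_neq0].
have cp := dom_chart_at sA p.
have u0 : change a (chart_at A p) p y != 0.
  apply/eqP => e; move/negP: y0; apply; apply/eqP.
  by apply: (change_inj sA ap cp); rewrite e change0.
exists (exist _ (p, change a (chart_at A p) p y) u0) => //.
by rewrite coord_slit /= change_trans // change_id.
Qed.

Lemma open_slit_overlap a b : open (@overlap _ _ N a b).
Proof.
rewrite slit_overlapE.
rewrite (_ : [set w | _] = (fst @^-1` overlap a b) `&` (snd @^-1` ~` [set 0])).
  apply: openI.
    by apply: open_comp => [w _|]; [exact: cvg_fst | exact: open_overlap].
  apply: open_comp => [w _|]; first exact: cvg_snd.
  apply: closed_openC; apply: accessible_closed_set1.
  by apply: hausdorff_accessible; exact: norm_hausdorff.
by apply/seteqP; split=> w [h /eqP h']; split=> //; apply/eqP.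
Qed.

Lemma slit_coord_inj a z z' : dom (a : chart_index N) z ->
  dom (a : chart_index N) z' -> @coord _ _ N a z = @coord _ _ N a z' -> z = z'.
Proof.
move=> az az' [e1 e2]; apply: val_inj.
case: z z' az az' e1 e2 => [[p y] y0] [[p' y'] y0'] /= ap ap' e1.
have e := coord_inj sA ap ap' e1; subst p'.
move=> e2; congr (_, _).
exact: (change_inj sA (dom_chart_at sA p) ap e2).
Qed.

(** The second component is the derivative of the transition map of M applied
    to the fibre coordinate. *)
Lemma slit_transitionE a b w : @overlap _ _ N a b w ->
  @transition _ _ _ N a b w =
  (transition a b w.1, 'd (transition a b) (w.1) w.2).
Proof.
move=> [z [az bz] <-]; have cz := dom_chart_at sA (base z).
rewrite [LHS](loc_inj _ _ az); last by move=> z' az' _; exact: slit_coord_inj.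
by rewrite !coord_slit /= transitionE // -(change_trans sA _ cz az bz).
Qed.

Lemma smooth_transition_fst a b k : Ck_on k (@overlap _ _ N a b)
  (fun w => transition a b w.1).
Proof.
apply: (Ck_comp B (@open_slit_overlap a b) (open_overlap sA a b)).
- by move=> w; rewrite slit_overlapE => -[].
- apply: (Ck_linear (L := fst) _ (@open_slit_overlap a b)) => w.
  exact: cvg_fst.
- exact: (smooth_transition sA).
Qed.

Lemma smooth_dtransition_fst a b (u : V) k : Ck_on k (@overlap _ _ N a b)
  (fun w => 'd (transition a b) (w.1) u).
Proof.
apply: (Ck_comp (f := fun x => 'd (transition a b) x u) B
  (@open_slit_overlap a b) (open_overlap sA a b)).
- by move=> w; rewrite slit_overlapE => -[].
- apply: (Ck_linear (L := fst) _ (@open_slit_overlap a b)) => w.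
  exact: cvg_fst.
- exact: (Ck_d u (smooth_transition sA a b k.+1)).
Qed.

Lemma smooth_slit_transition a b k :
  Ck_on k (@overlap _ _ N a b) (@transition _ _ _ N a b).
Proof.
have o := @open_slit_overlap a b.
apply: (Ck_ext o (fun w h => esym (slit_transitionE h))).
apply: (Ck_pair o (smooth_transition_fst a b k)).
apply: (Ck_lin_app B (L := fun w : V * V => 'd (transition a b) (w.1))
  (g := snd) o).
- by move=> w; exact: linearP.
- by move=> u; exact: smooth_dtransition_fst.
- by apply: (Ck_linear (L := snd) _ o) => w; exact: cvg_snd.
Qed.

Lemma smooth_slit_atlas : smooth_atlas N.
Proof.
split.
- by move=> z; exact: (dom_chart_at sA).
- exact: slit_coord_inj.
- exact: open_slit_overlap.
- exact: smooth_slit_transition.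
Qed.

(** The block triangular form, with equal diagonal blocks, of the derivative of
    (x, y) |-> (phi x, 'd phi x y). *)
Lemma slit_changeE a b z u : dom a (base z) -> dom b (base z) ->
  @change _ _ _ N a b z u = (change a b (base z) u.1,
    'd (fun x => 'd (transition a b) x (@coord _ _ N a z).2)
       (coord a (base z)) u.1 + change a b (base z) u.2).
Proof.
move=> az bz; set w := @coord _ _ N a z.
have ow : @overlap _ _ N a b w by exists z.
have ow1 : overlap a b w.1 by exists (base z).
have oo := @open_slit_overlap a b.
have d1 : is_diff w (fun w => transition a b w.1)
    (fun u => 'd (transition a b) (w.1) u.1).
  have h1 : is_diff w (fst : V * V -> V) fst.
    by apply: DiffDef; [apply: linear_differentiable|apply: diff_lin] => x;
      exact: cvg_fst.
  exact: (is_diff_comp h1 (differentiableP (transition_diff sA az bz))).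
have d3 y : is_diff w (fun w => 'd (transition a b) (w.1) y)
    (fun u => 'd (fun x => 'd (transition a b) x y) (w.1) u.1).
  have h1 : is_diff w (fst : V * V -> V) fst.
    by apply: DiffDef; [apply: linear_differentiable|apply: diff_lin] => x;
      exact: cvg_fst.
  have := (Ck_d y (smooth_transition sA a b 2)).1 _ ow1.
  by move=> /differentiableP h2; exact: (is_diff_comp h1 h2).
have h2 : is_diff w (snd : V * V -> V) snd.
  by apply: DiffDef; [apply: linear_differentiable|apply: diff_lin] => x;
    exact: cvg_snd.
have d2 := is_diff_lin_app B (L := fun w : V * V => 'd (transition a b) (w.1))
  (g := snd) (fun w => linearP _) (fun y => is_diff_ex (d3 y)) (is_diff_ex h2).
have n : \forall w \near w, (transition a b w.1, 'd (transition a b) (w.1) w.2) =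
    @transition _ _ _ N a b w.
  by apply: (open_near oo ow) => w' ow'; rewrite slit_transitionE.
apply: etrans (is_diff_near_val u n (is_diff_pair d1 d2)) _.
by congr (_, _); rewrite (is_diff_app u (d3 w.2)) (is_diff_app u h2).
Qed.

End Slit.

(** * Vertical endomorphism and Liouville field *)

Section VerticalEndomorphism.
Context {R : realType} {V : normedModType R}.

Lemma Jvec_linear : linear (@Jvec R V).
Proof.
by move=> a u w; apply: injective_projections; rewrite /= ?scaler0 ?addr0.
Qed.

HB.instance Definition _ := GRing.isLinear.Build R (V * V)%type (V * V)%type
  *:%R (@Jvec R V) Jvec_linear.

Lemma Jvec_continuous : continuous (@Jvec R V).
Proof. by move=> u; apply: cvg_pair; [exact: cvg_cst | exact: cvg_fst]. Qed.

Lemma JvecD (u w : V * V) : Jvec (u + w) = Jvec u + Jvec w.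
Proof. exact: linearD. Qed.

Lemma JvecZ (k : R) (u : V * V) : Jvec (k *: u) = k *: Jvec u.
Proof. exact: linearZ. Qed.

Lemma JvecN (u : V * V) : Jvec (- u) = - Jvec u.
Proof. exact: linearN. Qed.

Lemma JvecB (u w : V * V) : Jvec (u - w) = Jvec u - Jvec w.
Proof. exact: linearB. Qed.

Lemma JvecK (u : V * V) : Jvec (Jvec u) = 0.
Proof. by []. Qed.

Lemma Jvec_ker (u : V * V) : Jvec u = 0 -> u = Jvec (u.2, 0).
Proof. by case: u => x y [->]. Qed.

Context {M : Type} {A : atlas V M}.
Variable (B : fin_basis V) (sA : smooth_atlas A).

Notation N := (slit_atlas A).
Notation base z := (val z).1.
Implicit Types (a b : chart_index A) (z : slitTM V M) (X Y : slitTM V M -> V * V).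

Let sN : smooth_atlas N := smooth_slit_atlas B sA.
Let B2 : fin_basis (V * V)%type := prod_basis B B.

(** The vertical endomorphism does not depend on the induced chart, since the
    diagonal blocks in [slit_changeE] are equal. *)
Lemma change_Jvec a b z u : dom a (base z) -> dom b (base z) ->
  @change _ _ _ N a b z (Jvec u) = Jvec (@change _ _ _ N a b z u).
Proof.
move=> az bz; rewrite !(slit_changeE B sA) // /Jvec /=; congr (_, _).
  exact: linear0.
by rewrite linear0 add0r.
Qed.

Lemma vrep_J X a x : @coord_dom _ _ N a x ->
  @vrep _ _ _ N (J X) a x = Jvec (@vrep _ _ _ N X a x).
Proof.
move=> [z az <-].
rewrite (vrepE sN _ (az : @dom _ _ N a z)) (vrepE sN _ (az : @dom _ _ N a z)).
by rewrite change_Jvec //; exact: (dom_chart_at sA).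
Qed.

Lemma smooth_J X : smooth_vf N X -> smooth_vf N (J X).
Proof.
move=> sX a k; have oa := open_coord_dom sN a.
apply: (Ck_ext oa _ (Ck_linear_comp (L := @Jvec R V) oa Jvec_continuous (sX a k))).
by move=> x ax; rewrite vrep_J.
Qed.

Lemma dfieldJ X z u : smooth_vf N X ->
  @dfield _ _ _ N (J X) z u = Jvec (@dfield _ _ _ N X z u).
Proof.
move=> sX; have h := is_diff_vrep sN z sX.
apply: etrans (congr1 (@Jvec R V) (is_diff_app u h)).
apply: (dfield_near sN u _
  (is_diff_linear_comp (L := @Jvec R V) Jvec_continuous (is_diff_ex h))) => x ax.
by rewrite vrep_J.
Qed.

Lemma JE X z : J X z = Jvec (X z).
Proof. by []. Qed.

(** The vanishing of the Nijenhuis tensor of J: in induced charts J has constant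
    components, so it commutes with [dfield], and J^2 = 0. *)
Lemma bracket_JJ X Y : smooth_vf N X -> smooth_vf N Y ->
  bracket N (J X) (J Y) = J (bracket N (J X) Y) + J (bracket N X (J Y)).
Proof.
move=> sX sY; apply/funext => z.
rewrite fctE !(JE (bracket _ _ _)) !bracketE !dfieldJ // !JvecB !JvecK.
by rewrite subr0 sub0r.
Qed.

Lemma J_bracket_vertical X Y : smooth_vf N X -> smooth_vf N Y ->
  J X = 0 -> J Y = 0 -> J (bracket N X Y) = 0.
Proof.
move=> sX sY X0 Y0; apply/funext => z; rewrite JE bracketE JvecB -!dfieldJ //.
by rewrite X0 Y0 !(dfield0 sN) subr0.
Qed.

Lemma vrep_liouville a x : @coord_dom _ _ N a x ->
  @vrep _ _ _ N (@liouville R V M) a x = (0, x.2).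
Proof.
move=> [z az <-].
rewrite (vrepE sN _ (az : @dom _ _ N a z)) (slit_changeE B sA) //=; last first.
  exact: (dom_chart_at sA).
by rewrite change0 linear0 add0r.
Qed.

Lemma smooth_liouville : smooth_vf N (@liouville R V M).
Proof.
move=> a k; have oa := open_coord_dom sN a.
have c2 : Ck_on k (@coord_dom _ _ N a) (snd : V * V -> V).
  by apply: (Ck_linear (L := snd) _ oa) => w; exact: cvg_snd.
apply: (Ck_ext oa _ (Ck_pair oa (Ck_cst k (0 : V) oa) c2)) => x ax.
by rewrite vrep_liouville.
Qed.

Lemma dfield_liouville z u : @dfield _ _ _ N (@liouville R V M) z u = (0, u.2).
Proof.
have h2 x : is_diff x (snd : V * V -> V) snd.
  by apply: DiffDef; [apply: linear_differentiable|apply: diff_lin] => y;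
    exact: cvg_snd.
apply: (dfield_near sN u _
  (is_diff_pair (is_diff_cst (0 : V) _) (h2 _))) => x ax.
by rewrite vrep_liouville.
Qed.

(** [C, J] = - J: the derivative of C in an induced chart is the projection on
    the fibre directions, which fixes J X, and the derivatives of X cancel. *)
Lemma bracket_liouville_J X : smooth_vf N X ->
  bracket N (@liouville R V M) (J X) - J (bracket N (@liouville R V M) X) = - J X.
Proof.
move=> sX; apply/funext => z.
rewrite !fctE !JE !bracketE dfieldJ // !dfield_liouville JvecB.
rewrite [X in _ - X - _](_ : _ = Jvec (X z)) //.
rewrite [X in _ - (_ - X)](_ : _ = 0) //.
by rewrite subr0 addrAC subrr sub0r.
Qed.

End VerticalEndomorphism.

(** * Extension of tangent vectors to vector fields *)

Lemma smooth_manifold_atlas (R : realType) (V : normedModType R)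
    (T : topologicalType) (N : atlas V T) : smooth_manifold N -> smooth_atlas N.
Proof.
move=> [_ cN aN hN tN]; split.
- exact: cN.
- by move=> a p q ap aq; exact: (aN a).2.
- move=> a b; apply/(hN a); first by move=> p [].
  by apply: openI; [exact: (aN a).1 | exact: (aN b).1].
- by move=> a b; exact: tN.
Qed.

(** A cluster point in the chart of the image filter pulls back, since the
    chart is a homeomorphism onto its image. *)
Lemma compact_chart_preimage (R : realType) (V : normedModType R)
    (T : topologicalType) (N : atlas V T) (a : chart_index N) (K : set V) :
  smooth_manifold N -> compact K -> K `<=` coord_dom a ->
  compact (dom a `&` coord a @^-1` K).
Proof.
move=> mN cK Ka; have [_ _ aN hN _] := mN.
move=> F PF FK; have FG : F (coord a @^-1` K).
  by apply: (@filterS _ F _ (dom a `&` coord a @^-1` K)) FK => q [].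
have [x [Kx clx]] := cK _ (fmap_proper_filter _ PF) FG.
have [q aq qx] := Ka x Kx.
exists q; split; first by split=> //; rewrite /= qx.
move=> P Q FP nQ.
have [Q' [[oQ' qQ'] Q'Q]] : exists Q', open_nbhs q Q' /\ Q' `<=` Q.
  by move: nQ; rewrite nbhsE => -[Q' ? ?]; exists Q'.
have oQa : open (coord a @` (Q' `&` dom a)).
  apply/(hN a); first by move=> p [].
  by apply: openI => //; exact: (aN a).1.
have nx : nbhs x (coord a @` (Q' `&` dom a)).
  by apply: open_nbhs_nbhs; split=> //; exists q.
have FP' : (coord a @ F) (coord a @` (P `&` (dom a `&` coord a @^-1` K))).
  apply: (@filterS _ F _ (P `&` (dom a `&` coord a @^-1` K))) (filterI FP FK).
  by move=> p Pp; exists p.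
have [_ [[p [Pp [ap _]] <-] [p' [Q'p' ap'] e]]] := clx _ _ FP' nx.
exists p; split=> //; apply: Q'Q.
by rewrite -((aN a).2 _ _ ap' ap e).
Qed.

Section Extension.
Context {R : realType} {n : nat} {M : topologicalType} {A : atlas 'rV[R]_n M}.
Variable mA : smooth_manifold A.
Let sA : smooth_atlas A := smooth_manifold_atlas mA.
Let B : fin_basis 'rV[R]_n := rV_basis n.
Notation N := (slit_atlas A).
Let sN : smooth_atlas N := smooth_slit_atlas B sA.

(** Cut off the field with constant components by a bump function of the base
    point.  The preimage of its support is compact, hence closed in M by the
    Hausdorff property, and its complement is open in every chart. *)
Lemma smooth_extension z (u : 'rV[R]_n * 'rV[R]_n) :
  exists X, smooth_vf N X /\ X z = u.
Proof.
pose p := (val z).1; pose a := chart_at A p.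
have ap : dom a p by exact: (dom_chart_at sA).
have [rho [K [srho rhoc cK Ka rho0]]] :=
  bump_rV (open_coord_dom sA a) (coord_dom_in ap).
pose KM := dom a `&` coord a @^-1` K.
have [hM _ aN hN _] := mA.
have clK : closed KM.
  by apply: compact_closed => //; exact: compact_chart_preimage.
pose KT : set (slitTM 'rV[R]_n M) := [set z | KM (val z).1].
have srho2 k : Ck_on k setT (fun w : 'rV[R]_n * 'rV[R]_n => rho w.1).
  apply: (Ck_comp B openT openT (fun _ _ => I) _ (srho k)).
  by apply: (Ck_linear (L := fst) _ openT) => w; exact: cvg_fst.
have [X [sX XE]] : exists X, smooth_vf N X /\
  forall q, dom (a : chart_index N) q ->
    X q = rho (coord (a : chart_index N) q).1 *:
          change (a : chart_index N) (chart_at N q) q u.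
  apply: (@cutoff_extension _ _ _ N (prod_basis B B) sN a
    (fun w => rho w.1) KT u srho2).
  - by move=> q [].
  - move=> q aq nKq /=; apply: rho0 => Kq; apply: nKq; split => //.
  - move=> b; rewrite (_ : _ @` _ = @overlap _ _ N b b `&`
        (fst @^-1` (@coord _ _ A b @` (@dom _ _ A b `\` KM)))).
      apply: openI; first exact: (open_overlap sN).
      apply: open_comp => [w _|]; first exact: cvg_fst.
      apply/(hN b); first by move=> q [].
      rewrite setDE; apply: openI; first exact: (aN b).1.
      exact: closed_openC.
    apply/seteqP; split=> [_ [q [bq nKq] <-]|_ [[q [bq _] <-] [q' [bq' nKq'] e]]].
      by split; [exists q | exists (val q).1].
    exists q => //; split=> //.
    by rewrite /KT /= -(coord_inj sA bq' bq e).
exists X; split=> //.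
rewrite (XE z ap) (change_id sN _ (ap : @dom _ _ N a z)).
by rewrite /= rhoc scale1r.
Qed.

End Extension.

(** * The fundamental form *)

Section EnergyForm.
Context {R : realType} {n : nat} {M : topologicalType} {A : atlas 'rV[R]_n M}.
Variable E : TM 'rV[R]_n M -> R.
Hypothesis hE : finsler_space A E.
Notation V := 'rV[R]_n.
Notation N := (slit_atlas A).
Notation e := (slit_fun E).
Notation Om := (fundamental_form A E).
Notation C := (@liouville R V M).
Implicit Types (X Y Z : slitTM V M -> V * V) (z : slitTM V M).

Let mA : smooth_manifold A := finsler_manifold hE.
Let sA : smooth_atlas A := smooth_manifold_atlas mA.
Let B : fin_basis V := rV_basis n.
Let B2 : fin_basis (V * V)%type := prod_basis B B.
Let sN : smooth_atlas N := smooth_slit_atlas B sA.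
Let se : smooth_fun N e := finsler_smooth hE.

Notation hess := (@hessian _ _ _ N e).

Lemma hessC z u w : hess z u w = hess z w u.
Proof. exact: (hessianC sN). Qed.

Lemma hessDl z u u' w : hess z (u + u') w = hess z u w + hess z u' w.
Proof. exact: hessianDl. Qed.

Lemma hessZl z k u w : hess z (k *: u) w = k * hess z u w.
Proof. exact: hessianZl. Qed.

Lemma hess0l z w : hess z 0 w = 0.
Proof. by rewrite -(scale0r 0) hessZl mul0r. Qed.

(** In the chart at z, d_J E pairs with a constant vector w to 'd E (J w), so
    its exterior derivative is a skew combination of second derivatives of E. *)
Lemma Om_hessian z u w : Om z u w = hess z u (Jvec w) - hess z (Jvec u) w.
Proof.
rewrite (hessC z (Jvec u)).
set a := chart_at N z; have az : dom a z by exact: (dom_chart_at sN).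
have key v : {near coord a z,
    (fun x => 'd (loc e a) x (Jvec v)) =1
    orep (fun z u => dfun N e z (Jvec u)) a v}.
  apply: (open_near (open_coord_dom sN a) (coord_dom_in az)) => _ [q aq <-].
  have cq := dom_chart_at sN q.
  rewrite /orep locE // -change_Jvec // (loc_change sN _ aq cq) //.
  exact: smooth_fun_diff.
have k1 v u' : 'd (orep (fun z u => dfun N e z (Jvec u)) a v) (coord a z) u' =
    hess z u' (Jvec v).
  exact: (is_diff_near_val u' (key v) (is_diff_dloc sN z (Jvec v) se)).
by rewrite /fundamental_form /ext_d -/a !k1.
Qed.

Lemma Om_skew z u w : Om z u w = - Om z w u.
Proof. by rewrite /fundamental_form /ext_d opprB. Qed.

Lemma OmDl z u u' w : Om z (u + u') w = Om z u w + Om z u' w.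
Proof. by rewrite !Om_hessian JvecD !hessDl /=; ring. Qed.

Lemma OmZl z k u w : Om z (k *: u) w = k * Om z u w.
Proof. by rewrite !Om_hessian JvecZ /= !hessZl; ring. Qed.

Lemma OmNl z u w : Om z (- u) w = - Om z u w.
Proof. by rewrite -scaleN1r OmZl mulN1r. Qed.

Lemma OmBl z u u' w : Om z (u - u') w = Om z u w - Om z u' w.
Proof. by rewrite OmDl OmNl. Qed.

Lemma OmDr z u w w' : Om z u (w + w') = Om z u w + Om z u w'.
Proof. by rewrite (Om_skew z u) OmDl opprD (Om_skew z u w) (Om_skew z u w'). Qed.

Lemma OmNr z u w : Om z u (- w) = - Om z u w.
Proof. by rewrite (Om_skew z u) OmNl (Om_skew z u w). Qed.

Lemma OmBr z u w w' : Om z u (w - w') = Om z u w - Om z u w'.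
Proof. by rewrite OmDr OmNr. Qed.

Lemma Om0l z w : Om z 0 w = 0.
Proof. by rewrite -(scale0r 0) OmZl mul0r. Qed.

Lemma Om0r z w : Om z w 0 = 0.
Proof. by rewrite (Om_skew z w) Om0l oppr0. Qed.

(** i_J Omega = 0, by the symmetry of the second derivatives of E. *)
Lemma Om_J z u w : Om z (Jvec u) w = - Om z u (Jvec w).
Proof. by rewrite !Om_hessian !JvecK hess0l (hessC z u 0) hess0l; ring. Qed.

Lemma Om_JJ z u w : Om z (Jvec u) (Jvec w) = 0.
Proof. by rewrite Om_J JvecK Om0r oppr0. Qed.

Lemma std_basisE (u : V * V) :
  u = \sum_(i < n + n) row_mx u.1 u.2 0 i *: @std_basis R n i.
Proof.
have H : row_mx u.1 u.2 =
    \sum_(i < n + n) row_mx u.1 u.2 0 i *: delta_mx 0 i.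
  exact: row_sum_delta.
apply: injective_projections.
  rewrite -[LHS](row_mxKl _ u.2) [in LHS]H !linear_sum /=; apply: eq_bigr => i _.
  by rewrite linearZ.
rewrite -[LHS](row_mxKr u.1) [in LHS]H !linear_sum /=; apply: eq_bigr => i _.
by rewrite linearZ.
Qed.

(** A vector u in the kernel gives a row vector annihilated by the Gram matrix,
    which has full rank. *)
Lemma Om_nondegenerate z u : (forall w, Om z u w = 0) -> u = 0.
Proof.
move=> u0; set G := \matrix_(i < n + n, j < n + n)
  Om z (@std_basis R n i) (@std_basis R n j).
have fG : row_free G by rewrite /row_free; apply/eqP; exact: (finsler_rank hE z).
have c0 : row_mx u.1 u.2 *m G = 0.
  apply/rowP => j; rewrite [LHS]mxE [RHS]mxE -[RHS](u0 (@std_basis R n j)).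
  rewrite [in RHS](std_basisE u).
  rewrite (big_morph (fun v => Om z v (@std_basis R n j))
    (fun v v' => OmDl z v v' _) (Om0l z _)).
  by apply: eq_bigr => i _; rewrite OmZl [G i j]mxE.
have r0 : row_mx u.1 u.2 = 0 by apply: (row_free_inj fG); rewrite c0 mul0mx.
by rewrite (std_basisE u) r0 big1 // => i _; rewrite mxE scale0r.
Qed.

Definition dJE X : slitTM V M -> R := lie_fun N (J X) e.

Lemma smooth_dJE X : smooth_vf N X -> smooth_fun N (dJE X).
Proof.
by move=> sX; apply: (smooth_lie_fun B2 sN) => //; exact: smooth_J.
Qed.

Definition Om_field X Y : slitTM V M -> R := fun z => Om z (X z) (Y z).

(** Cartan's formula for Omega = d d_J E.  From here on Omega is handled through
    fields, with no reference to charts. *)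
Lemma Om_cartan X Y : smooth_vf N X -> smooth_vf N Y ->
  Om_field X Y = lie_fun N X (dJE Y) - lie_fun N Y (dJE X) - dJE (bracket N X Y).
Proof.
move=> sX sY; apply/funext => z; rewrite /Om_field Om_hessian !fctE.
have sJ := smooth_J B sA.
rewrite (lie_fun_lie_fun B2 sN) ?(lie_fun_lie_fun B2 sN (X := Y)) //; try exact: sJ.
rewrite !(dfieldJ B sA) // !JE /dJE /lie_fun JE bracketE JvecB dfunB.
by rewrite (hessC z (Jvec _)); ring.
Qed.

Lemma lie_dJE_bracket X Y Z : smooth_vf N X -> smooth_vf N Y -> smooth_vf N Z ->
  lie_fun N (bracket N X Y) (dJE Z) =
  lie_fun N X (lie_fun N Y (dJE Z)) - lie_fun N Y (lie_fun N X (dJE Z)).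
Proof.
by move=> sX sY sZ; apply: (lie_fun_bracket B2 sN) => //; exact: smooth_dJE.
Qed.

Lemma dJED X Y : dJE (X + Y) = dJE X + dJE Y.
Proof.
rewrite /dJE -lie_funDl; congr (lie_fun N _ e).
by apply/funext => z; rewrite JE !fctE JvecD.
Qed.

Lemma smooth_Om_field X Y : smooth_vf N X -> smooth_vf N Y ->
  smooth_fun N (Om_field X Y).
Proof.
move=> sX sY; rewrite Om_cartan //.
have sb := smooth_bracket B2 sN sX sY.
apply: (smooth_funB sN); last exact: smooth_dJE.
by apply: (smooth_funB sN); apply: (smooth_lie_fun B2 sN) => //; exact: smooth_dJE.
Qed.

(** d d = 0: expand by [Om_cartan]; second derivatives along fields cancel by
    [lie_fun_bracket], and the terms with double brackets by [jacobi]. *)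
Lemma Om_closed X Y Z z : smooth_vf N X -> smooth_vf N Y -> smooth_vf N Z ->
  lie_fun N X (Om_field Y Z) z + lie_fun N Y (Om_field Z X) z +
    lie_fun N Z (Om_field X Y) z =
  Om_field (bracket N X Y) Z z + Om_field (bracket N Y Z) X z +
    Om_field (bracket N Z X) Y z.
Proof.
move=> sX sY sZ.
have sb := smooth_bracket B2 sN; have so := smooth_dJE.
have sl := smooth_lie_fun B2 sN.
have key X' Y' Z' : smooth_vf N X' -> smooth_vf N Y' -> smooth_vf N Z' ->
    lie_fun N X' (Om_field Y' Z') = lie_fun N X' (lie_fun N Y' (dJE Z')) -
      lie_fun N X' (lie_fun N Z' (dJE Y')) - lie_fun N X' (dJE (bracket N Y' Z')).
  move=> sX' sY' sZ'; rewrite Om_cartan // !(lie_funB sN) //; auto.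
  by apply: (smooth_funB sN); auto.
have jac : dJE (bracket N (bracket N X Y) Z) z + dJE (bracket N (bracket N Y Z) X) z
    + dJE (bracket N (bracket N Z X) Y) z = 0.
  have : dJE (bracket N X (bracket N Y Z)) z =
      dJE (bracket N (bracket N X Y) Z) z + dJE (bracket N Y (bracket N X Z)) z.
    by rewrite (jacobi B2 sN) // dJED.
  have omN W : dJE (- W) z = - dJE W z.
    rewrite /dJE -[RHS]/((- lie_fun N (J W) e) z) -lie_funNl.
    by congr (lie_fun N _ e z); apply/funext => q; rewrite JE !fctE JvecN.
  rewrite (@bracketC _ _ _ N X (bracket N Y Z)) omN
    (@bracketC _ _ _ N Y (bracket N X Z)) omN.
  have -> : bracket N X Z = - bracket N Z X by exact: bracketC.
  rewrite (bracketNl sN) ?omN //; last by auto.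
  by lra.
pose L X' Y' Z' : R := lie_fun N X' (lie_fun N Y' (dJE Z')) z.
pose K X' Y' : R := lie_fun N X' (dJE Y') z.
pose W X' : R := dJE X' z.
have keyz X' Y' Z' : smooth_vf N X' -> smooth_vf N Y' -> smooth_vf N Z' ->
    lie_fun N X' (Om_field Y' Z') z = L X' Y' Z' - L X' Z' Y' - K X' (bracket N Y' Z').
  by move=> ? ? ?; rewrite key.
have cart X' Y' : smooth_vf N X' -> smooth_vf N Y' ->
    Om_field X' Y' z = K X' Y' - K Y' X' - W (bracket N X' Y').
  by move=> ? ?; rewrite Om_cartan.
have lb X' Y' Z' : smooth_vf N X' -> smooth_vf N Y' -> smooth_vf N Z' ->
    K (bracket N X' Y') Z' = L X' Y' Z' - L Y' X' Z'.
  by move=> ? ? ?; rewrite /K lie_dJE_bracket.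
have jacW : W (bracket N (bracket N X Y) Z) + W (bracket N (bracket N Y Z) X)
    + W (bracket N (bracket N Z X) Y) = 0 := jac.
clearbody L K W; rewrite !keyz // !cart; try by auto.
by rewrite !lb //; move: jacW; lra.
Qed.

(** Homogeneity is given on TM, in the charts of [tangent_atlas]; on nonzero
    vectors the two local representatives of E coincide. *)
Lemma lie_liouville_energy : lie_fun N C e = 2 *: e.
Proof.
apply/funext => z; rewrite fctE -[RHS](finsler_homogeneous hE (val z)).
rewrite /lie_fun /dfun.
have az : dom (chart_at N z) z by exact: (dom_chart_at sN).
have nE : {near coord (chart_at N z) z, loc e (chart_at N z) =1
    loc E (chart_at (tangent_atlas A) (val z))}.
  apply: (open_near (open_coord_dom sN (chart_at N z)) (coord_dom_in az)).
  move=> _ [q aq <-]; rewrite locE //.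
  apply/esym.
  apply: (@loc_inj _ _ _ _ (tangent_atlas A) E (chart_at A (val z).1) (val q)) => //.
  move=> [p y] ap _ [e1 e2]; case: q aq e1 e2 => [[p' y'] y0] /= ap' e1.
  have ep := coord_inj sA ap ap' e1; subst p'; move=> e2; congr (_, _).
  exact: (change_inj sA (dom_chart_at sA p) ap e2).
exact: esym (is_diff_near_val _ nE (differentiableP (smooth_fun_diff se az))).
Qed.

End EnergyForm.

(** * The spray and the Barthel connection *)

#[local] Opaque bracket.

Lemma half_double (R : realType) (W : normedModType R) (u : W) :
  2^-1 *: (u + u) = u.
Proof.
rewrite scalerDr -scalerDl (_ : 2^-1 + 2^-1 = 1 :> R) ?scale1r //.
by field.
Qed.

Section Barthel.
Context {R : realType} {n : nat} {M : topologicalType} {A : atlas 'rV[R]_n M}.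
Variable E : TM 'rV[R]_n M -> R.
Hypothesis hE : finsler_space A E.
Notation V := 'rV[R]_n.
Notation N := (slit_atlas A).
Notation e := (slit_fun E).
Notation Om := (fundamental_form A E).
Notation C := (@liouville R V M).
Notation OmF := (@Om_field R n M A E).
Notation dJEf := (@dJE R n M A E).
Implicit Types (X Y Z : slitTM V M -> V * V) (z : slitTM V M).

Let mA : smooth_manifold A := finsler_manifold hE.
Let sA : smooth_atlas A := smooth_manifold_atlas mA.
Let B : fin_basis V := rV_basis n.
Let B2 : fin_basis (V * V)%type := prod_basis B B.
Let sN : smooth_atlas N := smooth_slit_atlas B sA.
Let se : smooth_fun N e := finsler_smooth hE.
Let sJ := smooth_J B sA.
Let sb := smooth_bracket B2 sN.
Let sC : smooth_vf N C := smooth_liouville B sA.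

(** i_C d d_J E = L_C d_J E since d_J E vanishes on C, and L_C d_J E = d_J E by
    [C, J] = - J and the homogeneity of E. *)
Lemma Om_liouville X z : smooth_vf N X -> Om z (C z) (X z) = dJEf X z.
Proof.
have aux (p q r : R) : q - r = p - 2 * r -> p - 0 - q = r by lra.
move=> sX; rewrite -[LHS]/(OmF C X z) (Om_cartan hE sC sX) !fctE.
have omC0 : dJEf C = 0.
  rewrite /dJE (_ : J C = C - C); last by apply/funext => q; rewrite !fctE subrr.
  by rewrite lie_funBl subrr.
have l0 : lie_fun N X (dJEf C) z = 0.
  by rewrite omC0 -(subrr e) (lie_funB sN) // subrr.
have bC : bracket N C (J X) = J (bracket N C X) - J X.
  by rewrite -(bracket_liouville_J B sA sX) addrC subrK.
(* Both sides compute [C, JX] E; the last term is 2 JX(E) by homogeneity. *)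
have c : lie_fun N (bracket N C (J X)) e z =
    lie_fun N C (dJEf X) z - lie_fun N (J X) (2 *: e) z.
  by rewrite (lie_fun_bracket B2 sN sC (sJ sX) se) (lie_liouville_energy hE).
rewrite bC lie_funBl in c.
have e2 : lie_fun N (J X) (2 *: e) z = 2 * dJEf X z.
  rewrite (_ : 2 *: e = e + e); last first.
    by apply/funext => q; rewrite !fctE /GRing.scale /=; ring.
  by rewrite (lie_funD sN) // !fctE /dJE; ring.
rewrite l0; rewrite e2 !fctE in c; rewrite -/(dJEf (bracket N C X)) in c.
exact: aux c.
Qed.

Variable S : slitTM V M -> V * V.
Hypothesis hS : canonical_spray A E S.
Let sS : smooth_vf N S := hS.1.

(** i_(JS) Omega = d_J E = i_C Omega: the first equality is i_S Omega = - dE read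
    through [Om_J], the second one is [Om_liouville]. *)
Lemma J_spray : J S = C.
Proof.
apply/funext => z; apply/eqP; rewrite -subr_eq0; apply/eqP.
apply: (Om_nondegenerate hE (z := z)) => w.
have [X [sX <-]] := smooth_extension mA z w.
rewrite (OmBl hE) Om_liouville // JE (Om_J hE) hS.2 opprK.
by rewrite -[dJEf X z]/(dfun N e z (Jvec (X z))) subrr.
Qed.

Lemma barthelE X : barthel A S X = J (bracket N S X) - bracket N S (J X).
Proof. by rewrite /barthel /fn_form_vec /fn_vec_form opprB. Qed.

Lemma barthel_at X z :
  barthel A S X z = Jvec (bracket N S X z) - bracket N S (J X) z.
Proof. by rewrite barthelE. Qed.

Lemma smooth_barthel X : smooth_vf N X -> smooth_vf N (barthel A S X).
Proof.
move=> sX; rewrite barthelE; apply: (smooth_vfB sN); first exact/sJ/sb.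
by apply: sb => //; exact: sJ.
Qed.

Lemma smooth_hproj X : smooth_vf N X -> smooth_vf N (hproj A S X).
Proof.
move=> sX; apply: (smooth_vfZ sN); apply: (smooth_vfD sN) => //.
exact: smooth_barthel.
Qed.

(** J[S, JX] = - JX, which is the Nijenhuis identity for S and X with J S = C and
    [C, J] = - J. *)
Lemma J_barthel X z : smooth_vf N X -> Jvec (barthel A S X z) = Jvec (X z).
Proof.
move=> sX; rewrite barthelE.
have H : J (bracket N S (J X)) = - J X.
  have := bracket_JJ B sA sS sX; rewrite J_spray => h.
  rewrite -(bracket_liouville_J B sA sX) h [X in X - _]addrC addrK //.
have Hz : Jvec (bracket N S (J X) z) = - Jvec (X z).
  by rewrite -[LHS]/(J _ z) H.
by rewrite !fctE JvecB Hz JvecK opprK add0r.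
Qed.

Lemma hproj_at X z : hproj A S X z = 2^-1 *: (X z + barthel A S X z).
Proof. by []. Qed.

Lemma J_hproj X z : smooth_vf N X -> Jvec (hproj A S X z) = Jvec (X z).
Proof.
move=> sX; rewrite hproj_at JvecZ JvecD J_barthel //; exact: half_double.
Qed.

Variable F : slitTM V M -> V * V -> V * V.
Hypothesis hF : almost_complex A S F.

(** F J, which is the projector h, as an operator on single tangent vectors; [hproj]
    is defined on fields only. *)
Definition horizontal z (u : V * V) : V * V := F z (Jvec u).

(** F J = h shows that h, which is defined through brackets, is tensorial. *)
Lemma hprojE X z : smooth_vf N X -> hproj A S X z = horizontal z (X z).
Proof. by move=> sX; rewrite -(hF.2 X sX).1. Qed.

Lemma F_linear z : linear (F z).
Proof. by move=> k u w; exact: (hF.1).1. Qed.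

Lemma FD z u w : F z (u + w) = F z u + F z w.
Proof. by have := F_linear z 1 u w; rewrite !scale1r. Qed.

Lemma F0 z : F z 0 = 0.
Proof. by apply: (addrI (F z 0)); rewrite -FD !addr0. Qed.

Lemma FN z u : F z (- u) = - F z u.
Proof. by apply/eqP; rewrite -addr_eq0 -FD addNr F0. Qed.

Lemma FB z u w : F z (u - w) = F z u - F z w.
Proof. by rewrite FD FN. Qed.

Lemma horB z u w : horizontal z (u - w) = horizontal z u - horizontal z w.
Proof. by rewrite /horizontal JvecB FB. Qed.

Lemma hor_vertical z u : Jvec u = 0 -> horizontal z u = 0.
Proof. by move=> u0; rewrite /horizontal u0 F0. Qed.

Lemma J_hor z u : Jvec (horizontal z u) = Jvec u.
Proof.
have [X [sX <-]] := smooth_extension mA z u.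
by rewrite -hprojE // J_hproj.
Qed.

Lemma hor_hor z u : horizontal z (horizontal z u) = horizontal z u.
Proof. by rewrite {1}/horizontal J_hor. Qed.

Lemma F_hor z u : F z (horizontal z u) = - Jvec u.
Proof.
have [X [sX <-]] := smooth_extension mA z u.
rewrite -hprojE //; have h := (hF.2 X sX).2.
by rewrite -[LHS]/((fun z => F z (hproj A S X z)) z) h.
Qed.

Lemma barthel_hproj X : smooth_vf N X ->
  barthel A S (hproj A S X) = hproj A S X.
Proof.
move=> sX; have sh := smooth_hproj sX; apply/funext => z.
have : hproj A S (hproj A S X) z = hproj A S X z.
  by rewrite hprojE // hprojE // hor_hor.
rewrite [LHS]hproj_at => h; set W := hproj A S X z in h *.
by apply: (addrI W); rewrite -[LHS]half_double scalerDr h.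
Qed.

Lemma Om_spray X : smooth_vf N X -> OmF S X = - lie_fun N X e.
Proof. by move=> sX; apply/funext => z; rewrite /Om_field hS.2. Qed.

(** L_S Omega = 0: Omega is closed and i_S Omega = - dE is closed. *)
Lemma lie_spray_Om X Y z : smooth_vf N X -> smooth_vf N Y ->
  lie_fun N S (OmF X Y) z =
  OmF (bracket N S X) Y z + OmF X (bracket N S Y) z.
Proof.
have aux (p q r s t : R) : p + q - r = s + (q - r) + t -> p = s + t by lra.
move=> sX sY; have := Om_closed hE z sS sX sY.
have OmC X' Y' : OmF X' Y' = - OmF Y' X'.
  by apply/funext => q; rewrite !fctE /Om_field Om_skew.
have -> : OmF Y S = lie_fun N Y e by rewrite OmC Om_spray // opprK.
rewrite (Om_spray sX) (OmC _ S) (Om_spray (sb sX sY)) opprK.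
rewrite (lie_funN sN) ?(lie_fun_bracket B2 sN) //; last first.
  exact: (smooth_lie_fun B2 sN).
rewrite (@bracketC _ _ _ N Y S).
have -> : OmF (- bracket N S Y) X = OmF X (bracket N S Y).
  by rewrite OmC; apply/funext => q; rewrite !fctE /Om_field (OmNr hE) opprK.
rewrite !fctE.
exact: aux.
Qed.

(** The derivative along S of Omega(JX, Y) + Omega(X, JY) = 0, as
    Gamma = - [S, J] and L_S Omega = 0. *)
Lemma Om_barthel X Y z : smooth_vf N X -> smooth_vf N Y ->
  Om z (barthel A S X z) (Y z) + Om z (X z) (barthel A S Y z) = 0.
Proof.
have aux (p q r s : R) : p - q = - (r + s) -> - r - p + (q - s) = 0 by lra.
move=> sX sY.
have J0 : OmF (J X) Y = - OmF X (J Y).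
  by apply/funext => q; rewrite !fctE /Om_field !JE (Om_J hE).
have := congr1 (fun f => lie_fun N S f z) J0.
rewrite (lie_funN sN); last by apply: (smooth_Om_field hE) => //; exact: sJ.
rewrite -[X in _ = X -> _]/(- lie_fun N S (OmF X (J Y)) z).
rewrite !lie_spray_Om //; try exact: sJ.
rewrite /Om_field !barthel_at JE.
rewrite (OmBl hE z (Jvec (bracket N S X z))) (OmBr hE z _ (Jvec (bracket N S Y z))).
rewrite (Om_J hE z (X z)) (Om_J hE z (bracket N S X z)).
exact: aux.
Qed.

(** The horizontal distribution is Lagrangian: Gamma is the identity on
    horizontal fields, so [Om_barthel] gives 2 Omega(hX, hY) = 0. *)
Lemma Om_hor z u w : Om z (horizontal z u) (horizontal z w) = 0.
Proof.
have aux0 (p : R) : p + p = 0 -> p = 0 by lra.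
have aux (a a' b b' : V * V) : a' = a -> b' = b ->
    Om z a' b + Om z a b' = 0 -> Om z a b = 0.
  by move=> -> ->; exact: aux0.
have [X [sX <-]] := smooth_extension mA z u.
have [Y [sY <-]] := smooth_extension mA z w.
rewrite -(hprojE z sX) -(hprojE z sY).
exact: aux (congr1 (fun f => f z) (barthel_hproj sX))
  (congr1 (fun f => f z) (barthel_hproj sY))
  (Om_barthel z (smooth_hproj sX) (smooth_hproj sY)).
Qed.

(** [J, Gamma] = 0: bracketing the Nijenhuis identity of J with S, which acts as
    a derivation, and subtracting the identities for ([S, X], Y) and
    (X, [S, Y]). *)
Lemma barthel_torsion X Y z : smooth_vf N X -> smooth_vf N Y ->
  bracket N (barthel A S X) (J Y) z + bracket N (J X) (barthel A S Y) z -
  (barthel A S (bracket N (J X) Y) z + barthel A S (bracket N X (J Y)) z) =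
  Jvec (bracket N (barthel A S X) Y z) + Jvec (bracket N X (barthel A S Y) z).
Proof.
have aux (t1 t2 b1 b2 c1 c2 g1 g2 a1 a2 p1 p2 q1 q2 r1 r2 s1 s2 u1 u2 : V * V) :
    t1 = g1 - r1 -> g1 = p1 + p2 -> t2 = g2 - r2 -> g2 = q1 + q2 ->
    b1 = a1 - s1 -> a1 = u1 + q1 -> b2 = a2 - s2 -> a2 = p2 + u2 ->
    s1 + s2 = r1 + r2 -> c1 = p1 - u1 -> c2 = q2 - u2 ->
    t1 + t2 - (b1 + b2) = c1 + c2.
  do 8 move=> ->; move=> /eqP; rewrite -subr_eq => /eqP <- -> ->.
  apply: (bco_inj (B := B2)) => i; rewrite !(raddfB, raddfD) /=; ring.
move=> sX sY.
have [sJX sJY] := (sJ sX, sJ sY).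
have [sSX sSY] := (sb sS sX, sb sS sY).
have [sSJX sSJY] := (sb sS sJX, sb sS sJY).
have [sJSX sJSY] := (sJ sSX, sJ sSY).
have n1 : bracket N (J (bracket N S X)) (J Y) z =
    Jvec (bracket N (J (bracket N S X)) Y z) +
    Jvec (bracket N (bracket N S X) (J Y) z).
  exact: (congr1 (fun f => f z) (bracket_JJ B sA sSX sY)).
have n2 : bracket N (J X) (J (bracket N S Y)) z =
    Jvec (bracket N (J X) (bracket N S Y) z) +
    Jvec (bracket N X (J (bracket N S Y)) z).
  exact: (congr1 (fun f => f z) (bracket_JJ B sA sX sSY)).
(* The bracket of S with the Nijenhuis identity for X and Y. *)
have n3 : bracket N S (J (bracket N (J X) Y)) z +
    bracket N S (J (bracket N X (J Y))) z =
    bracket N (bracket N S (J X)) (J Y) z + bracket N (J X) (bracket N S (J Y)) z.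
  rewrite -[LHS]/((bracket N S (J (bracket N (J X) Y)) +
    bracket N S (J (bracket N X (J Y)))) z).
  rewrite -(bracketDr sN sS (sJ (sb sJX sY)) (sJ (sb sX sJY))).
  by rewrite -(bracket_JJ B sA sX sY) (jacobi B2 sN sS sJX sJY).
have n4 : Jvec (bracket N S (bracket N (J X) Y) z) =
    Jvec (bracket N (bracket N S (J X)) Y z) +
    Jvec (bracket N (J X) (bracket N S Y) z).
  exact: etrans (congr1 (fun f => Jvec (f z)) (jacobi B2 sN sS sJX sY))
    (JvecD _ _).
have n5 : Jvec (bracket N S (bracket N X (J Y)) z) =
    Jvec (bracket N (bracket N S X) (J Y) z) +
    Jvec (bracket N X (bracket N S (J Y)) z).
  exact: etrans (congr1 (fun f => Jvec (f z)) (jacobi B2 sN sS sX sJY))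
    (JvecD _ _).
have bl Z : smooth_vf N Z -> bracket N (barthel A S X) Z z =
    bracket N (J (bracket N S X)) Z z - bracket N (bracket N S (J X)) Z z.
  move=> sZ; rewrite (barthelE X).
  exact: (congr1 (fun f => f z) (bracketBl sN sJSX sSJX sZ)).
have br Z : smooth_vf N Z -> bracket N Z (barthel A S Y) z =
    bracket N Z (J (bracket N S Y)) z - bracket N Z (bracket N S (J Y)) z.
  move=> sZ; rewrite (barthelE Y).
  exact: (congr1 (fun f => f z) (bracketBr sN sZ sJSY sSJY)).
have c1 := etrans (congr1 (@Jvec R V) (bl _ sY)) (JvecB _ _).
have c2 := etrans (congr1 (@Jvec R V) (br _ sX)) (JvecB _ _).
exact: (aux _ _ _ _ _ _ _ _ _ _ _ _ _ _ _ _ _ _ _ _ (bl _ sJY) n1 (br _ sJX) n2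
  (barthel_at (bracket N (J X) Y) z) n4 (barthel_at (bracket N X (J Y)) z) n5
  n3 c1 c2).
Qed.

End Barthel.

(** * The Chern connection *)

Section Chern.
Context {R : realType} {n : nat} {M : topologicalType} {A : atlas 'rV[R]_n M}.
Notation V := 'rV[R]_n.
Notation N := (slit_atlas A).
Notation VF := (slitTM V M -> V * V).
Variables (E : TM V M -> R) (hE : finsler_space A E).
Variables (S : VF) (hS : canonical_spray A E S).
Variables (F : slitTM V M -> V * V -> V * V) (hF : almost_complex A S F).
Variables (D : VF -> VF -> VF) (hD : chern_connection A E S F D).
Notation Om := (fundamental_form A E).
Implicit Types (X Y Z : VF) (z : slitTM V M).

Let mA : smooth_manifold A := finsler_manifold hE.
Let sA : smooth_atlas A := smooth_manifold_atlas mA.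
Let B : fin_basis V := rV_basis n.
Let B2 : fin_basis (V * V)%type := prod_basis B B.
Let sN : smooth_atlas N := smooth_slit_atlas B sA.
Let sJ := smooth_J B sA.
Let sD := conn_smooth (chern_linear hD).
Let addD := conn_addr (chern_linear hD).

(* The bracket, h and Gamma are variables here, equal to the actual operations
   by hypothesis: the computations treat them through the relations proved next. *)
Variables (br : VF -> VF -> VF) (br_def : br = bracket N).
Variables (h G : VF -> VF) (h_def : h = hproj A S) (G_def : G = barthel A S).
Notation hor := (horizontal F).

Let sb X Y : smooth_vf N X -> smooth_vf N Y -> smooth_vf N (br X Y).
Proof. by rewrite br_def => sX sY; exact: (smooth_bracket B2 sN sX sY). Qed.

Let sG X : smooth_vf N X -> smooth_vf N (G X).
Proof. by rewrite G_def => sX; exact: (smooth_barthel hE hS sX). Qed.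

Let sH X : smooth_vf N X -> smooth_vf N (h X).
Proof. by rewrite h_def => sX; exact: (smooth_hproj hE hS sX). Qed.

Let sV X : smooth_vf N X -> smooth_vf N (X - h X).
Proof. by move=> sX; exact: (smooth_vfB sN sX (sH sX)). Qed.

Let brC X Y : br X Y = - br Y X.
Proof. by rewrite br_def; exact: bracketC. Qed.

Let brBl X Y Z z : smooth_vf N X -> smooth_vf N Y -> smooth_vf N Z ->
  br (X - Y) Z z = br X Z z - br Y Z z.
Proof. by rewrite br_def => sX sY sZ; rewrite (bracketBl sN). Qed.

Let brBr X Y Z z : smooth_vf N X -> smooth_vf N Y -> smooth_vf N Z ->
  br X (Y - Z) z = br X Y z - br X Z z.
Proof. by rewrite br_def => sX sY sZ; rewrite (bracketBr sN). Qed.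

Let hG X z : h X z = 2^-1 *: (X z + G X z).
Proof. by rewrite h_def G_def. Qed.

Let h_at X z : smooth_vf N X -> h X z = hor z (X z).
Proof. by rewrite h_def => sX; exact: (hprojE hF z sX). Qed.

Let Gh X : smooth_vf N X -> G (h X) = h X.
Proof. by rewrite h_def G_def => sX; exact: (barthel_hproj hE hS hF sX). Qed.

Let Jh X : smooth_vf N X -> J (h X) = J X.
Proof.
by rewrite h_def => sX; apply/funext => z; exact: (J_hproj hE hS z sX).
Qed.

Let JvX X : smooth_vf N X -> J (X - h X) = 0.
Proof.
move=> sX; apply/funext => z; rewrite -[LHS]/(Jvec (X z - h X z)) JvecB.
by rewrite -[Jvec (h X z)]/(J (h X) z) Jh // subrr.
Qed.

Let torsionE X Y z : torsion N D X Y z = D X Y z - D Y X z - br X Y z.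
Proof. by rewrite br_def. Qed.

Let DJ X Y : smooth_vf N X -> smooth_vf N Y -> D X (J Y) = J (D X Y).
Proof. by move=> sX sY; exact: (chern_J hD sX sY). Qed.

Let DJJ X Y : smooth_vf N X -> smooth_vf N Y -> D (J X) (J Y) = J (br (J X) Y).
Proof. by rewrite br_def => sX sY; exact: (chern_vertical hD sX sY). Qed.

Let DG X Y : smooth_vf N X -> smooth_vf N Y -> D X (G Y) = G (D X Y).
Proof. by rewrite G_def => sX sY; exact: (chern_Gamma hD sX sY). Qed.

Let JT X Y z : smooth_vf N X -> smooth_vf N Y ->
  Jvec (torsion N D (h X) (h Y) z) = 0.
Proof.
rewrite h_def => sX sY.
exact: (congr1 (fun f => f z) (chern_torsion hD sX sY)).
Qed.

Let br_JJ X Y : smooth_vf N X -> smooth_vf N Y ->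
  br (J X) (J Y) = J (br (J X) Y) + J (br X (J Y)).
Proof. by rewrite br_def => sX sY; exact: (bracket_JJ B sA sX sY). Qed.

Let br_torsion X Y z : smooth_vf N X -> smooth_vf N Y ->
  br (G X) (J Y) z + br (J X) (G Y) z - (G (br (J X) Y) z + G (br X (J Y)) z) =
  Jvec (br (G X) Y z) + Jvec (br X (G Y) z).
Proof. by rewrite br_def G_def => sX sY; exact: (barthel_torsion hE hS z sX sY). Qed.

Let hor_br X Y z : smooth_vf N X -> smooth_vf N Y ->
  J X = 0 -> J Y = 0 -> hor z (br X Y z) = 0.
Proof.
rewrite br_def => sX sY X0 Y0; apply: (hor_vertical hF).
exact: (congr1 (fun f => f z) (J_bracket_vertical B sA sX sY X0 Y0)).
Qed.

(** From D Gamma = 0, since 2 h = id + Gamma. *)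
Lemma conn_hproj X Y : smooth_vf N X -> smooth_vf N Y -> D X (h Y) = h (D X Y).
Proof.
move=> sX sY; have sh := sH sY.
have dbl W : h W + h W = W + G W.
  apply/funext => z; rewrite -[LHS]/(h W z + h W z) hG -scalerDr.
  by rewrite half_double.
have e : D X (h Y) + D X (h Y) = h (D X Y) + h (D X Y).
  by rewrite -(addD sX sh sh) !dbl (addD sX sY (sG sY)) DG.
apply/funext => z; have ez := congr1 (fun f => 2^-1 *: f z) e.
by rewrite -[LHS]half_double -[RHS]half_double.
Qed.

Lemma conn_hproj_at X Y z : smooth_vf N X -> smooth_vf N Y ->
  D X (h Y) z = hor z (D X Y z).
Proof. by move=> sX sY; rewrite conn_hproj // (h_at z (sD sX sY)). Qed.

Lemma torsion_vv X Y : smooth_vf N X -> smooth_vf N Y ->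
  torsion N D (J X) (J Y) = 0.
Proof.
move=> sX sY; apply/funext => z; rewrite torsionE (DJJ sX sY) (DJJ sY sX).
rewrite (br_JJ sX sY) (brC X (J Y)).
rewrite -[LHS]/(Jvec (br (J X) Y z) - Jvec (br (J Y) X z) -
  (Jvec (br (J X) Y z) + Jvec (- br (J Y) X z))).
by rewrite JvecN subrr.
Qed.

(** The torsion is vertical, hence annihilated by h; on the other hand h fixes
    both covariant derivatives. *)
Lemma torsion_hh_at X Y z : smooth_vf N X -> smooth_vf N Y ->
  torsion N D (h X) (h Y) z = hor z (br (h X) (h Y) z) - br (h X) (h Y) z.
Proof.
move=> sX sY; have [sU sW] := (sH sX, sH sY).
have t0 : hor z (torsion N D (h X) (h Y) z) = 0.
  by apply: (hor_vertical hF); exact: JT.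
rewrite torsionE (horB hF) (horB hF) in t0.
rewrite (conn_hproj_at z sU sY) (conn_hproj_at z sW sX) in t0.
rewrite !(hor_hor hE hS hF) in t0.
rewrite torsionE (conn_hproj_at z sU sY) (conn_hproj_at z sW sX).
by move/eqP: t0; rewrite subr_eq0 => /eqP ->.
Qed.

(** h[vX, vY] = 0 expresses h[hX, hY] through the other terms of [h, h]. *)
Lemma torsion_hh X Y : smooth_vf N X -> smooth_vf N Y ->
  torsion N D (h X) (h Y) = curvature A S X Y.
Proof.
have aux (b k l m t : V * V) : k - m - (l - t) = 0 ->
    t - b = - (2^-1 *: (b + b + k + k - m - l - m - l)).
  move=> /eqP; rewrite subr_eq0 => /eqP km.
  have -> : b + b + k + k - m - l - m - l = (b - t) + (b - t).
    have -> : t = l - (k - m) by rewrite km opprB addrC subrK.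
    by apply: (bco_inj (B := B2)) => i; rewrite !(raddfB, raddfD) /=; ring.
  by rewrite half_double opprB.
move=> sX sY; have [sU sW] := (sH sX, sH sY).
apply/funext => z; rewrite (torsion_hh_at z sX sY).
have -> : curvature A S X Y z = - (2^-1 *: (br (h X) (h Y) z + br (h X) (h Y) z
    + h (h (br X Y)) z + h (h (br X Y)) z
    - h (br X (h Y)) z - h (br (h X) Y) z
    - h (br X (h Y)) z - h (br (h X) Y) z)) by rewrite br_def h_def.
have hh : h (h (br X Y)) z = hor z (br X Y z).
  have s1 := sb sX sY; rewrite (h_at z (sH s1)) (h_at z s1).
  exact: (hor_hor hE hS hF).
rewrite hh (h_at z (sb sX sW)) (h_at z (sb sU sY)).
apply: aux.
have := hor_br z (sV sX) (sV sY) (JvX sX) (JvX sY).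
by rewrite (brBl z sX sU (sV sY)) (brBr z sX sY sW) (brBr z sU sY sW) !(horB hF).
Qed.

(** The subtracted term v[hX, JY] is the horizontal derivative of the Berwald
    connection. *)
Definition berwald_difference X Y z : V * V := D (h X) (J Y) z -
  (br (h X) (J Y) z - hor z (br (h X) (J Y) z)).

(** D_JY hX = h[JY, X] because h commutes with D and J D_JY X = J[JY, X]; replacing
    X by hX changes the bracket by a vertical field. *)
Lemma torsion_hv X Y z : smooth_vf N X -> smooth_vf N Y ->
  torsion N D (h X) (J Y) z = berwald_difference X Y z.
Proof.
move=> sX sY; have sU := sH sX; have sJY := sJ sY.
have e1 : D (J Y) (h X) z = hor z (br (J Y) X z).
  rewrite (conn_hproj_at z sJY sX) /horizontal; congr (F z _).
  by rewrite -[LHS]/(J (D (J Y) X) z) -DJ // DJJ.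
have e2 : hor z (br (J Y) X z) = - hor z (br (h X) (J Y) z).
  have := hor_br z sJY (sV sX) (erefl _) (JvX sX).
  rewrite (brBr z sJY sX sU) (horB hF) => /eqP; rewrite subr_eq0 => /eqP ->.
  rewrite (brC (J Y)) -[X in hor z X]/(- br (h X) (J Y) z).
  by rewrite /horizontal JvecN (FN hF).
by rewrite torsionE e1 e2 opprK /berwald_difference opprB addrA.
Qed.

Lemma J_berwald_difference X Y z : smooth_vf N X -> smooth_vf N Y ->
  Jvec (berwald_difference X Y z) = 0.
Proof.
move=> sX sY; rewrite /berwald_difference (DJ (sH sX) sY) !JvecB JE JvecK.
by rewrite (J_hor hE hS hF) subrr subr0.
Qed.

(** J T(hX, hY) = 0 gives D_hX JY - D_hY JX = J[hX, hY], and [barthel_torsion] on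
    horizontal fields gives v[hX, JY] - v[hY, JX] = J[hX, hY]. *)
Lemma berwald_differenceC X Y z : smooth_vf N X -> smooth_vf N Y ->
  berwald_difference X Y z = berwald_difference Y X z.
Proof.
have aux (dx dy jb bx by' hx hy gx gy : V * V) :
    dx - dy - jb = 0 -> bx - by' - (- gy + gx) = jb + jb ->
    hx = 2^-1 *: (bx + gx) -> hy = 2^-1 *: (by' + gy) ->
    dx - (bx - hx) = dy - (by' - hy).
  move=> /eqP; rewrite subr_eq0 => /eqP <- e -> ->.
  have {}e : bx - gx - (by' - gy) = dx - dy + (dx - dy).
    rewrite -e; apply: (bco_inj (B := B2)) => i.
    by rewrite !(raddfB, raddfD, raddfN) /=; ring.
  have {}e : 2^-1 *: (bx - gx) - 2^-1 *: (by' - gy) = dx - dy.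
    by rewrite -scalerBr e half_double.
  have hb (b g : V * V) : b - 2^-1 *: (b + g) = 2^-1 *: (b - g).
    rewrite -[X in X - _ = _](half_double b) -scalerBr; congr (_ *: _).
    by rewrite opprD addrACA subrr add0r.
  rewrite !hb; move/eqP: e; rewrite subr_eq => /eqP ->.
  by apply: (bco_inj (B := B2)) => i; rewrite !(raddfB, raddfD) /=; ring.
move=> sX sY; have [sU sW] := (sH sX, sH sY); have [sJX sJY] := (sJ sX, sJ sY).
have t := br_torsion z sU sW.
rewrite (Gh sX) (Gh sY) (Jh sX) (Jh sY) in t.
have jb := JT z sX sY; rewrite torsionE !JvecB in jb.
have dJ X' Y' : smooth_vf N X' -> smooth_vf N Y' ->
    Jvec (D (h X') (h Y') z) = D (h X') (J Y') z.
  by move=> sX' sY'; rewrite -(Jh sY') (DJ (sH sX') (sH sY')).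
rewrite (dJ _ _ sX sY) (dJ _ _ sY sX) in jb.
have sXY := sb sU sJY; have sYX := sb sJX sW.
apply: (aux _ _ _ _ _ _ _ (G (br (h X) (J Y)) z) (- G (br (J X) (h Y)) z) jb).
- by rewrite (brC (h Y)) -[X in _ - X - _]/(- br (J X) (h Y) z) !opprK.
- by rewrite -(h_at z sXY) hG.
- rewrite (brC (h Y)) -[X in hor z X]/(- br (J X) (h Y) z).
  rewrite -[X in X - G _ _]/(- br (J X) (h Y) z).
  by rewrite /horizontal JvecN (FN hF) -/(horizontal F z _) -(h_at z sYX) hG -opprD scalerN.
Qed.

(** By horizontal metricity the derivative of g(JY, JZ) is given by D, so only
    D_hX - [hX, .] remains.  Its values on JY and JZ differ from B by horizontal
    vectors, which do not contribute since the horizontal distribution is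
    Lagrangian. *)
Lemma lie_metricE X Y Z z :
  smooth_vf N X -> smooth_vf N Y -> smooth_vf N Z ->
  lie_metric A E F (h X) (J Y) (J Z) z =
  Om z (berwald_difference X Y z) (Z z) + Om z (berwald_difference X Z z) (Y z).
Proof.
have aux (a b c d : R) : a + b - c - d = (a - c) + (b - d) by ring.
move=> sX sY sZ; have sU := sH sX; have [sJY sJZ] := (sJ sY, sJ sZ).
have cm : lie_fun N (h X) (metric A E F (J Y) (J Z)) z =
    Om z (D (h X) (J Y) z) (F z (J Z z)) + Om z (J Y z) (F z (D (h X) (J Z) z)).
  have := congr1 (fun f => f z) (chern_metric hD sX sJY sJZ).
  by rewrite -h_def.
have vertl (u w : V * V) : Jvec u = 0 -> Om z u (hor z w) = Om z u w.
  move=> /Jvec_ker ->.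
  by rewrite (Om_J hE) (J_hor hE hS hF) -(Om_J hE).
have vertr (u w : V * V) : Jvec u = 0 -> Om z (Jvec w) (F z u) = Om z u w.
  move=> /Jvec_ker e; rewrite {1}e -/(horizontal F z _).
  by rewrite (Om_J hE) (J_hor hE hS hF) -e [RHS]Om_skew.
have dE W : D (h X) (J W) z - br (h X) (J W) z =
    berwald_difference X W z - hor z (br (h X) (J W) z).
  by rewrite /berwald_difference opprB [X in _ + X - _]addrC addrA addrK.
have -> : lie_metric A E F (h X) (J Y) (J Z) z =
    lie_fun N (h X) (metric A E F (J Y) (J Z)) z
    - Om z (br (h X) (J Y) z) (F z (J Z z))
    - Om z (J Y z) (F z (br (h X) (J Z) z)) by rewrite br_def.
rewrite cm -(vertl _ _ (J_berwald_difference z sX sY)).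
rewrite -(vertr _ (Y z) (J_berwald_difference z sX sZ)).
have e1 : Om z (D (h X) (J Y) z) (F z (J Z z)) -
    Om z (br (h X) (J Y) z) (F z (J Z z)) =
    Om z (berwald_difference X Y z) (hor z (Z z)).
  by rewrite -(OmBl hE) dE (OmBl hE) (Om_hor hE hS hF) subr0.
have e2 : Om z (J Y z) (F z (D (h X) (J Z) z)) -
    Om z (J Y z) (F z (br (h X) (J Z) z)) =
    Om z (Jvec (Y z)) (F z (berwald_difference X Z z)).
  rewrite -(OmBr hE) -(FB hF) dE (FB hF) (F_hor hE hF) opprK (OmDr hE).
  by rewrite (Om_JJ hE) addr0.
by rewrite -e1 -e2; exact: aux.
Qed.

Variables (C' : slitTM V M -> V * V -> V * V -> V * V).
Hypothesis hC' : cartan_prime A E S F C'.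

(** Q(X, Y, Z) = Omega(B(X, Y), Z) is symmetric in its first two arguments, and
    the symmetry of C' with [lie_metricE] makes it symmetric in the first and
    third.  So it is totally symmetric and equal to Omega(C'(X, Y), Z). *)
Lemma berwald_differenceE X Y z : smooth_vf N X -> smooth_vf N Y ->
  berwald_difference X Y z = C' z (X z) (Y z).
Proof.
move=> sX sY; have [[_ C'sym _] _ C'E] := hC'.
pose Q X Y Z := Om z (berwald_difference X Y z) (Z z).
have Q12 X1 X2 X3 : smooth_vf N X1 -> smooth_vf N X2 -> Q X1 X2 X3 = Q X2 X1 X3.
  by move=> s1 s2; rewrite /Q berwald_differenceC.
have C'Q X1 X2 X3 : smooth_vf N X1 -> smooth_vf N X2 -> smooth_vf N X3 ->
    Om z (C' z (X1 z) (X2 z)) (X3 z) = 2^-1 * (Q X1 X2 X3 + Q X1 X3 X2).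
  move=> s1 s2 s3; rewrite C'E // -h_def.
  by rewrite lie_metricE.
have QE X1 X2 X3 : Om z (berwald_difference X1 X2 z) (X3 z) = Q X1 X2 X3 by [].
clearbody Q.
have Q13 X1 X2 X3 : smooth_vf N X1 -> smooth_vf N X2 -> smooth_vf N X3 ->
    Q X1 X2 X3 = Q X3 X2 X1.
  move=> s1 s2 s3; have := C'Q X1 X3 X2 s1 s3 s2.
  rewrite C'sym (C'Q X3 X1 X2 s3 s1 s2) (Q12 X3 X1) // => /(mulfI _) e.
  by apply/esym/(addrI (Q X1 X3 X2)); apply: e; rewrite invr_eq0 pnatr_eq0.
have Q23 X1 X2 X3 : smooth_vf N X1 -> smooth_vf N X2 -> smooth_vf N X3 ->
    Q X1 X2 X3 = Q X1 X3 X2.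
  move=> s1 s2 s3; apply: (etrans (Q12 X1 X2 X3 s1 s2)).
  exact: etrans (Q13 X2 X1 X3 s2 s1 s3) (Q12 X3 X1 X2 s3 s1).
apply/eqP; rewrite -subr_eq0; apply/eqP; apply: (Om_nondegenerate hE (z := z)).
move=> w; have [Z [sZ <-]] := smooth_extension mA z w.
have half (q : R) : q - 2^-1 * (q + q) = 0 by field.
rewrite (OmBl hE z (berwald_difference X Y z)) QE (C'Q X Y Z sX sY sZ).
by rewrite -(Q23 X Y Z sX sY sZ); exact: half.
Qed.

End Chern.

Theorem proposition4p3 (R : realType) (n : nat) (M : topologicalType)
    (A : atlas 'rV[R]_n M) (E : TM 'rV[R]_n M -> R)
    (hE : finsler_space A E)
    (S : slitTM 'rV[R]_n M -> 'rV[R]_n * 'rV[R]_n)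
    (hS : canonical_spray A E S)
    (F : slitTM 'rV[R]_n M -> 'rV[R]_n * 'rV[R]_n -> 'rV[R]_n * 'rV[R]_n)
    (hF : almost_complex A S F)
    (C' : slitTM 'rV[R]_n M -> 'rV[R]_n * 'rV[R]_n -> 'rV[R]_n * 'rV[R]_n ->
          'rV[R]_n * 'rV[R]_n)
    (hC' : cartan_prime A E S F C')
    (D : (slitTM 'rV[R]_n M -> 'rV[R]_n * 'rV[R]_n) ->
         (slitTM 'rV[R]_n M -> 'rV[R]_n * 'rV[R]_n) ->
         (slitTM 'rV[R]_n M -> 'rV[R]_n * 'rV[R]_n))
    (hD : chern_connection A E S F D) :
  forall X Y : slitTM 'rV[R]_n M -> 'rV[R]_n * 'rV[R]_n,
  smooth_vf (slit_atlas A) X -> smooth_vf (slit_atlas A) Y ->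
  [/\ torsion (slit_atlas A) D (hproj A S X) (hproj A S Y)
        = curvature A S X Y,
      torsion (slit_atlas A) D (hproj A S X) (J Y)
        = (fun z => C' z (X z) (Y z)) &
      torsion (slit_atlas A) D (J X) (J Y) = 0].
Proof.
move=> X Y sX sY; split.
- exact: (torsion_hh hE hS hF hD erefl erefl erefl sX sY).
- apply/funext => z.
  rewrite (torsion_hv hE hS hF hD erefl erefl erefl z sX sY).
  exact: (berwald_differenceE hE hS hF hD erefl erefl erefl hC' z sX sY).
- exact: (torsion_vv hE hD erefl sX sY).
Qed.
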